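(* Let $k\ge 3$ be an integer, let $a$ be a non-zero constant, and let $(M_{\mathbb{C}},g)$ be the anti-self-dual Ricci-flat four-manifold corresponding to the twistor space $\mathcal{Z}$ with patching relations $$\widetilde{Q}=\lambda^{-k}Q,\qquad \tilde{\tau}=\lambda^{k-2}\tau+a\lambda^{-2}Q^2 .$$ The metric $g$ admits a tri-holomorphic Killing vector $K$. Away from the region of $M_{\mathbb{C}}$ where the normal bundle of the rational curves jumps to $\mathcal{O}(k)\oplus\mathcal{O}(2-k)$, it can therefore be put by a coordinate transformation (which removes that region) in the Gibbons–Hawking form $$g=V\,h_{flat}+V^{-1}(dT+A)^2,\qquad dV=*\,dA,\qquad K=\partial/\partial T.$$ Here $X,Y,Z$ are flat coordinates on $\mathbb{C}^3$ (or $\mathbb{R}^{1,2}$), $h_{flat}$ is the flat metric $dX^2-dY^2-dZ^2$ up to a constant scale, and the Gibbons–Hawking potential is $$V(X,Y,Z)=\frac{1}{2(k-1)!}\,\frac{\partial^{k-1}}{\partial\lambda^{k-1}}\Big(\lambda^2(X-Y)+2\lambda Z+(X+Y)\Big)^{-1/2}\Big|_{\lambda=0}.$$ For $k=3$ and $k=4$ this agrees with the potentials read off directly from $V=g(K,K)^{-1}$, which in the normalisation $a=1$ are respectively $$V=-\frac{X^2-Y^2-3Z^2}{4(X+Y)^{5/2}},\qquad V=\frac{Z(3X^2-3Y^2-5Z^2)}{4(X+Y)^{7/2}}.$$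
   Context: $\mathcal{O}(m)$ is the holomorphic line bundle over $\mathbb{CP}^1$ of Chern class $m$, and $\lambda$, $\tilde\lambda=\lambda^{-1}$ are affine coordinates on the two standard open sets of $\mathbb{CP}^1$. The twistor space $\mathcal{Z}$ is the complex three-fold obtained by gluing charts with coordinates $(\lambda,Q,\tau)$ and $(\tilde\lambda,\widetilde Q,\tilde\tau)$ by the stated relations. It is an affine line bundle over the total space of $\mathcal{O}(k)$, and it fibres over $\mathbb{CP}^1$. $M_{\mathbb{C}}$ is the complex four-manifold parametrising the holomorphic sections $L_p$ of $\mathcal{Z}\to\mathbb{CP}^1$. Writing $Q=x_k\lambda^k+\dots+x_1\lambda+x_0$, these are the sections of $\mathcal{O}(k)$ for which the coefficients of $\lambda^n$ in $Q^2$ vanish for $3\le n\le k-1$. The functions $x_0,x_1,x_2,x_k$ are coordinates on an open set in $M_{\mathbb{C}}$, and $K=\partial/\partial x_k$. For generic $p$ the normal bundle of $L_p$ is $\mathcal{O}(1)\oplus\mathcal{O}(1)$. A vector in $T_pM_{\mathbb{C}}$ is null iff the corresponding section of the normal bundle of $L_p$ vanishes at a point, i.e. iff $\delta\widetilde Q=0$ and $\delta\tilde\tau=0$ have a common solution $\lambda$. This defines an anti-self-dual conformal class $[g]$. The metric $g$ is the Ricci-flat metric in $[g]$ (with a choice of constant scale) singled out by the $\mathcal{O}(2)$-valued symplectic form $d\widetilde Q\wedge d\tilde\tau$ on the fibres of $\mathcal{Z}\to\mathbb{CP}^1$. This form gives rise to the basis of parallel self-dual two-forms on $M_{\mathbb{C}}$.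 A Killing vector is tri-holomorphic if it Lie-derives each of these two-forms to zero. $*$ is the Hodge operator of $h_{flat}$, $V$ is a function and $A$ a one-form on $\mathbb{C}^3$ (or $\mathbb{R}^{1,2}$).
   Formalization: Stated over C^3 on the part of M_C with x_0 ≠ 0 and normal bundle O(1)+O(1), not merely away from O(k)+O(2-k): where x_0 = 0, K is null so no Gibbons–Hawking form exists, and at other jumps g is undefined; the R^{1,2} real slice is not stated. *)

(* Defs.v *)
(* Everything is holomorphic: scalars are the
   complex numbers R[i] over a realType R, and derivatives are complex
   derivatives. *)
From HB Require Import structures.
From mathcomp Require Import all_boot all_order all_algebra.
From mathcomp Require Import all_classical all_reals all_analysis.
From mathcomp Require Import complex.
From mathcomp Require Import zify.

Set Implicit Arguments.
Unset Strict Implicit.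
Unset Printing Implicit Defensive.

Import Order.TTheory GRing.Theory Num.Theory.
Import numFieldNormedType.Exports.

Local Open Scope classical_set_scope.
Local Open Scope ring_scope.

(* The packed form makes the normed-space structure that MathComp-Analysis puts
   on any numClosedFieldType available on R[i]. *)
Definition Cplx (R : realType) : numClosedFieldType := R[i].

(** * Twistor lines *)

(* The curve (lambda, Q, tau), (lambda~, Qt, taut) is a section of Z -> CP^1;
   lambda~ = lambda^-1. *)
Definition twistor_line (C : numClosedFieldType) (k : nat) (a : C)
    (Q tau Qt taut : {poly C}) : Prop :=
  forall l : C, l != 0 ->
    Qt.[l^-1] = l ^- k * Q.[l] /\
    taut.[l^-1] = l ^+ (k - 2) * tau.[l] + a * l ^- 2 * Q.[l] ^+ 2.

Definition moduli (C : numClosedFieldType) (k : nat) (Q : {poly C}) : Prop :=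
  (size Q <= k.+1)%N /\
  forall n : nat, (3 <= n <= k - 1)%N -> (Q ^+ 2)`_n = 0.

(* The remaining components of the twistor line determined by Q; these are the
   only possible ones by twistor_lineP below. *)
Definition lineQt (C : numClosedFieldType) (k : nat) (Q : {poly C}) : {poly C} :=
  \poly_(i < k.+1) Q`_(k - i).

Definition linetaut (C : numClosedFieldType) (a : C) (Q : {poly C}) : {poly C} :=
  \poly_(i < 3) (a * (Q ^+ 2)`_(2 - i)).

Definition linetau (C : numClosedFieldType) (k : nat) (a : C) (Q : {poly C}) :
    {poly C} :=
  \poly_(i < k.+1) (- a * (Q ^+ 2)`_(k + i)).

(* A point of the chart is x = (x_0, x_1, x_2, x_k), with x_0 != 0.  The
   coefficients x_3, ..., x_(k-1) are obtained by solving (Q^2)_n = 0 for x_n. *)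
Fixpoint lowcoefs (C : numClosedFieldType) (x : 'rV[C]_4) (n : nat) : seq C :=
  if n is m.+1 then
    let s := lowcoefs x m in
    rcons s (if (m < 3)%N then x 0 (inord m)
             else - (\sum_(1 <= i < m) s`_i * s`_(m - i)) / (2 * x 0 0))
  else [::].

Definition curveQ (C : numClosedFieldType) (k : nat) (x : 'rV[C]_4) : {poly C} :=
  \poly_(i < k.+1) (if i == k then x 0 3 else (lowcoefs x k)`_i).

Definition chart_coords (C : numClosedFieldType) (k : nat) (Q : {poly C}) :
    'rV[C]_4 :=
  \row_(i < 4) Q`_(if i == 3 then k else i).

Lemma size_lowcoefs (C : numClosedFieldType) (x : 'rV[C]_4) (n : nat) :
  size (lowcoefs x n) = n.
Proof. by elim: n => //= n IH; rewrite size_rcons IH. Qed.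

Lemma lowcoefs_nth (C : numClosedFieldType) (x : 'rV[C]_4) (n m : nat) :
  (m < n)%N ->
  (lowcoefs x n)`_m =
    if (m < 3)%N then x 0 (inord m)
    else - (\sum_(1 <= i < m) (lowcoefs x n)`_i * (lowcoefs x n)`_(m - i))
           / (2 * x 0 0).
Proof.
elim: n => // n IH; rewrite ltnS leq_eqVlt => /orP[/eqP ->|mn] /=.
  rewrite nth_rcons size_lowcoefs ltnn eqxx; case: ifP => // _.
  congr (- _ / _); apply: eq_big_nat => i /andP[i1 i_n].
  rewrite !nth_rcons !size_lowcoefs i_n ifT //.
  by rewrite ltn_subrL i1 (leq_trans _ i_n).
rewrite nth_rcons size_lowcoefs mn IH //; case: ifP => // _.
congr (- _ / _); apply: eq_big_nat => i /andP[i1 i_m].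
rewrite !nth_rcons !size_lowcoefs (ltn_trans i_m mn) ifT //.
by rewrite (leq_ltn_trans (leq_subr _ _) mn).
Qed.

Lemma coef_sqr_split (C : numClosedFieldType) (p : {poly C}) (n : nat) :
  (0 < n)%N ->
  (p ^+ 2)`_n = 2 * p`_0 * p`_n + \sum_(1 <= i < n) p`_i * p`_(n - i).
Proof.
move=> n0; rewrite expr2 coefM.
rewrite -(big_mkord xpredT (fun i => p`_i * p`_(n - i))) big_ltn // subn0.
rewrite big_nat_recr //= subnn [p`_n * _]mulrC.
by rewrite mulr2n !mulrDl !mul1r addrCA addrC.
Qed.

(* curveQ k is the inverse of the chart (x_0, x_1, x_2, x_k) of the moduli space
   on the open set x_0 != 0: the next two lemmas. *)
Lemma curveQ_moduli (C : numClosedFieldType) (k : nat) (x : 'rV[C]_4) :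
  (3 <= k)%N -> x 0 0 != 0 ->
  moduli k (curveQ k x) /\ chart_coords k (curveQ k x) = x.
Proof.
move=> k3 x0.
have Qn n : (n < k)%N -> (curveQ k x)`_n = (lowcoefs x k)`_n.
  by move=> nk; rewrite coef_poly ltnS (ltnW nk) (ltn_eqF nk).
have k0 : (0 < k)%N by apply: leq_trans k3.
split; first split.
- exact: size_poly.
- move=> n /andP[n3 nk].
  have {}nk : (n < k)%N by rewrite -(subnK k0) addn1 ltnS.
  rewrite coef_sqr_split; last by apply: leq_trans n3.
  rewrite !Qn // [X in _ * X]lowcoefs_nth //.
  rewrite (lowcoefs_nth x k0) /= ltnNge n3 /=.
  have -> : inord 0 = 0 :> 'I_4 by apply/val_inj; rewrite /= inordK.
  rewrite mulrC divfK ?mulf_neq0 ?pnatr_eq0 // addrC; apply/eqP; rewrite subr_eq0.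
  apply/eqP; apply: eq_big_nat => i /andP[i1 i_n].
  by rewrite !Qn ?(leq_ltn_trans (leq_subr _ _) nk) // (ltn_trans i_n nk).
- apply/rowP => i; rewrite mxE; case: eqP => [->|/eqP i3].
    by rewrite coef_poly ltnSn eqxx.
  have {}i3 : (i < 3)%N.
    by rewrite ltn_neqAle -ltnS ltn_ord andbT; apply: contraNneq i3 => /= e; apply/eqP/val_inj.
  rewrite Qn ?(leq_trans i3 k3) // lowcoefs_nth ?(leq_trans i3 k3) // i3.
  by rewrite inord_val.
Qed.

Lemma moduli_curveQ (C : numClosedFieldType) (k : nat) (Q : {poly C}) :
  (3 <= k)%N -> Q`_0 != 0 -> moduli k Q -> curveQ k (chart_coords k Q) = Q.
Proof.
move=> k3 Q0 [sQ mQ]; set x := chart_coords k Q.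
have x00 : x 0 0 = Q`_0 by rewrite mxE.
have low n : (n < k)%N -> (lowcoefs x k)`_n = Q`_n.
  elim/ltn_ind: n => n IH nk; rewrite lowcoefs_nth //.
  case: ltnP => n3.
    have n4 : (n < 4)%N by apply: ltnW.
    rewrite mxE; case: eqP => [/(congr1 val)/=|_]; last by rewrite inordK.
    by rewrite inordK // => e; rewrite e in n3.
  have nk1 : (n <= k - 1)%N by rewrite -(leq_add2r 1) subnK ?addn1 // (leq_trans _ k3).
  have := mQ n; rewrite n3 nk1 => /(_ isT).
  rewrite coef_sqr_split; last by apply: leq_trans n3.
  move=> /eqP; rewrite addr_eq0 => /eqP e.
  rewrite x00 (_ : \sum_(1 <= i < n) _ = \sum_(1 <= i < n) Q`_i * Q`_(n - i)).
    have Q2 : 2 * Q`_0 != 0 by rewrite mulf_neq0 // pnatr_eq0.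
    by apply: (mulfI Q2); rewrite e [LHS]mulrC divfK.
  by apply: eq_big_nat => i /andP[i1 i_n]; rewrite !IH //; lia.
apply/polyP => n; rewrite coef_poly ltnS; case: ltngtP => // [nk|nk|->].
- exact: low.
- by rewrite nth_default // (leq_trans sQ).
- by rewrite mxE.
Qed.

Lemma poly_eq_nz (C : numClosedFieldType) (p q : {poly C}) :
  (forall l : C, l != 0 -> p.[l] = q.[l]) -> p = q.
Proof.
move=> h; apply/eqP; rewrite -subr_eq0; apply: contraT => nz.
set rs : seq C := [seq i%:R | i <- iota 1 (size (p - q))].
have rs_root : all (root (p - q)) rs.
  apply/allP => y /seq.mapP /= [i + ->]; rewrite mem_iota => /andP[i1 _].
  by rewrite rootE hornerD hornerN h ?subrr // pnatr_eq0 -lt0n.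
have rs_uniq : uniq rs.
  by rewrite map_inj_uniq ?iota_uniq // => i j /eqP; rewrite eqr_nat => /eqP.
have := max_poly_roots nz rs_root rs_uniq.
by rewrite size_map size_iota ltnn.
Qed.

(* (flip N p).[l] = l^N p.[1/l] when size p <= N.+1 *)
Definition flip (C : numClosedFieldType) (N : nat) (p : {poly C}) : {poly C} :=
  \poly_(i < N.+1) p`_(N - i).

Lemma flipE (C : numClosedFieldType) (N : nat) (p : {poly C}) (l : C) :
  (size p <= N.+1)%N -> l != 0 -> (flip N p).[l] = l ^+ N * p.[l^-1].
Proof.
move=> sp l0; rewrite horner_poly (horner_coef_wide _ sp) mulr_sumr.
rewrite (reindex_inj rev_ord_inj) /=; apply: eq_bigr => i _.
have iN : (i <= N)%N by rewrite -ltnS.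
rewrite subSS subKn // mulrCA; congr (_ * _).
apply: (mulIf (expf_neq0 i l0)).
by rewrite -exprD subnK // -mulrA -exprMn mulVf // expr1n mulr1.
Qed.

Lemma coef_flip (C : numClosedFieldType) (N : nat) (p : {poly C}) (i : nat) :
  (flip N p)`_i = if (i <= N)%N then p`_(N - i) else 0.
Proof. by rewrite coef_poly ltnS. Qed.

Lemma twistor_line_poly (C : numClosedFieldType) (k : nat) (a : C)
    (Q tau Qt taut : {poly C}) (N : nat) :
  (3 <= k)%N -> (size Qt <= N.+1)%N -> (size taut <= N.+1)%N ->
  twistor_line k a Q tau Qt taut <->
  'X^k * flip N Qt = 'X^N * Q /\
  'X^2 * flip N taut = 'X^N * ('X^k * tau + a *: Q ^+ 2).
Proof.
move=> k3 sQt staut; have kE : k = (2 + (k - 2))%N by rewrite subnKC // ltnW.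
have E1 (l : C) : l != 0 -> Qt.[l^-1] = l ^- k * Q.[l] <->
    ('X^k * flip N Qt).[l] = ('X^N * Q).[l].
  move=> l0; rewrite !hornerM !hornerXn flipE // mulrCA.
  have lN : l ^+ N != 0 by rewrite expf_neq0.
  have lk : l ^+ k != 0 by rewrite expf_neq0.
  split=> [->|/(mulfI lN) <-]; first by rewrite mulVKf.
  by rewrite mulKf.
have E2 (l : C) : l != 0 -> taut.[l^-1] = l ^+ (k - 2) * tau.[l] + a * l ^- 2 * Q.[l] ^+ 2 <->
    ('X^2 * flip N taut).[l] = ('X^N * ('X^k * tau + a *: Q ^+ 2)).[l].
  move=> l0.
  have lN : l ^+ N != 0 by rewrite expf_neq0.
  have l2 : l ^+ 2 != 0 by rewrite expf_neq0.
  set t := l ^+ (k - 2) * tau.[l] + a * l ^- 2 * Q.[l] ^+ 2.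
  have -> : ('X^2 * flip N taut).[l] = l ^+ N * (l ^+ 2 * taut.[l^-1]).
    by rewrite hornerM hornerXn flipE // mulrCA.
  have -> : ('X^N * ('X^k * tau + a *: Q ^+ 2)).[l] = l ^+ N * (l ^+ 2 * t).
    rewrite hornerM hornerD hornerZ hornerM !hornerXn horner_exp; congr (_ * _).
    rewrite /t mulrDr mulrA -exprD -kE -[a * _ * _]mulrA.
    by rewrite [l ^+ 2 * (a * _)]mulrCA mulVKf.
  by split=> [->//|e]; apply: (mulfI l2); apply: (mulfI lN).
split=> [L|[e1 e2] l l0]; last by split; [apply/E1 => //; rewrite e1|apply/E2 => //; rewrite e2].
by split; apply: poly_eq_nz => l l0; have [h1 h2] := L l l0; [apply/E1|apply/E2].
Qed.

(* The twistor lines are parametrised by the points of [moduli]. *)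
Lemma twistor_lineP (C : numClosedFieldType) (k : nat) (a : C)
    (Q tau Qt taut : {poly C}) :
  (3 <= k)%N -> a != 0 ->
  twistor_line k a Q tau Qt taut <->
  [/\ moduli k Q, Qt = lineQt k Q, tau = linetau k a Q & taut = linetaut a Q].
Proof.
move=> k3 a0.
pose N := (size Qt + size taut + k)%N.
have sQt : (size Qt <= N.+1)%N by rewrite /N; lia.
have staut : (size taut <= N.+1)%N by rewrite /N; lia.
rewrite (twistor_line_poly a Q tau k3 sQt staut).
have kN : (k <= N)%N by rewrite /N; lia.
have Q2k (j : nat) : (size Q <= k.+1)%N -> (k + k < j)%N -> (Q ^+ 2)`_j = 0.
  move=> sQ kj; rewrite nth_default // expr2 (leq_trans (size_polyMleq _ _)) //.
  by lia.
split=> [[e1 e2]|[[sQ mQ] eQt etau etaut]].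
  have c1 i := congr1 (fun p : {poly C} => p`_i) e1.
  have c2 i := congr1 (fun p : {poly C} => p`_i) e2.
  have Qj j : Q`_j = if (j <= k)%N then Qt`_(k - j) else 0.
    have := c1 (N + j)%N; rewrite !coefXnM coef_flip ltnNge (leq_trans kN) ?leq_addr //=.
    rewrite ltnNge leq_addr /= addKn => <-.
    case: leqP => jk; last by rewrite ifF //; lia.
    by rewrite ifT; [congr (nth _ _ _)|]; lia.
  have Qtj j : (k < j)%N -> Qt`_j = 0.
    move=> kj; case: (leqP j N) => jN; last by rewrite nth_default // (leq_trans sQt).
    have := c1 (N + k - j)%N; rewrite !coefXnM coef_flip.
    rewrite ifF; last by lia.
    rewrite ifT; last by lia.
    rewrite [RHS]ifT; last by lia.
    by move=> e; rewrite -[RHS]e; congr (nth _ _ _); lia.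
  have sQ : (size Q <= k.+1)%N by apply/leq_sizeP => j kj; rewrite Qj leqNgt kj.
  have Tj j : tau`_j = - a * (Q ^+ 2)`_(k + j).
    have := c2 (N + (k + j))%N; rewrite !coefXnM coef_flip coefD coefZ coefXnM.
    rewrite ifF; last by lia.
    rewrite ifF; last by lia.
    rewrite ifF; last by lia.
    rewrite addKn ifF; last by lia.
    by rewrite addKn mulNr => /esym/eqP; rewrite addr_eq0 => /eqP.
  have Q2j j : (j < k)%N -> a * (Q ^+ 2)`_j = if (j <= 2)%N then taut`_(2 - j) else 0.
    move=> jk; have := c2 (N + j)%N; rewrite !coefXnM coef_flip coefD coefZ coefXnM.
    rewrite ifF; last by lia.
    rewrite [X in _ = X -> _]ifF; last by lia.
    rewrite addKn jk add0r => <-.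
    case: leqP => j2; last by rewrite ifF //; lia.
    by rewrite ifT; [congr (nth _ _ _)|]; lia.
  have tautj j : (2 < j)%N -> taut`_j = 0.
    move=> kj; case: (leqP j N) => jN; last by rewrite nth_default // (leq_trans staut).
    have := c2 (N + 2 - j)%N; rewrite !coefXnM coef_flip.
    rewrite ifF; last by lia.
    rewrite ifT; last by lia.
    rewrite [RHS]ifT; last by lia.
    by move=> e; rewrite -[RHS]e; congr (nth _ _ _); lia.
  split; first split=> // n /andP[n3 nk].
  - have nk' : (n < k)%N by lia.
    have := Q2j n nk'; rewrite ifF; last by lia.
    by move/eqP; rewrite mulf_eq0 (negbTE a0) => /eqP.
  - apply/polyP => j; rewrite coef_poly; case: ltnP => jk; last by rewrite Qtj.
    by rewrite Qj ifT; [congr (nth _ _ _)|]; lia.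
  - apply/polyP => j; rewrite coef_poly Tj; case: ltnP => jk //.
    by rewrite Q2k ?mulr0 //; lia.
  - apply/polyP => j; rewrite coef_poly; case: ltnP => jk; last by rewrite tautj.
    rewrite Q2j; last by lia.
    by rewrite ifT; [congr (nth _ _ _)|]; lia.
split; apply/polyP => i.
  rewrite !coefXnM coef_flip eQt coef_poly.
  case: ltnP => ik; first by rewrite ifT //; lia.
  case: (ltnP i N) => iN.
    rewrite ifT; last by lia.
    by rewrite ifF //; lia.
  case: (leqP (i - k) N) => ikN; last first.
    by rewrite nth_default //; apply: (leq_trans sQ); lia.
  by rewrite ifT; [congr (nth _ _ _)|]; lia.
rewrite !coefXnM coef_flip coefD coefZ coefXnM etaut etau !coef_poly.
case: ltnP => ik; first by rewrite ifT //; lia.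
case: (ltnP i N) => iN.
  rewrite ifT; last by lia.
  by rewrite ifF //; lia.
case: (leqP (i - 2) N) => ikN.
  rewrite ifT; last by lia.
  rewrite [X in _ = X + _]ifT; last by lia.
  by rewrite add0r; congr (_ * nth _ _ _); lia.
case: ltnP => iNk.
  by rewrite add0r mQ ?mulr0 //; lia.
case: ltnP => iNk2.
  by rewrite subnKC // mulNr addNr.
by rewrite add0r Q2k ?mulr0 //; lia.
Qed.

(** * Normal bundles *)

(* Fibrewise Jacobian of the patching map along the line: maps
   (delta Q, delta tau) to (delta Qt, delta taut). *)
Definition normal_gluing (C : numClosedFieldType) (k : nat) (a : C)
    (Q : {poly C}) (l : C) : 'M[C]_2 :=
  \matrix_(i < 2, j < 2)
    if i == 0 then (if j == 0 then l ^- k else 0)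
    else (if j == 0 then 2 * a * l ^- 2 * Q.[l] else l ^+ (k - 2)).

(* The normal bundle is isomorphic to O(m) + O(n): H and Ht are changes of frame
   over the charts lambda and lambda~.  Holomorphic bundles over CP^1 and their
   isomorphisms are algebraic, so the frames are polynomial. *)
Definition normal_bundle_splits (C : numClosedFieldType) (k : nat) (a : C)
    (Q : {poly C}) (m n : int) : Prop :=
  exists H Ht : 'M[{poly C}]_2,
    [/\ H \in unitmx, Ht \in unitmx &
     forall l : C, l != 0 ->
       map_mx (horner_eval l^-1) Ht *m normal_gluing k a Q l =
       diag_mx (\row_(i < 2) (if i == 0 then l ^ (- m) else l ^ (- n))) *m
         map_mx (horner_eval l) H].

(* The part of the chart x_0 != 0 on which the conformal structure is defined.
   K = d/dx_k is null exactly where x_0 = 0, so that no Gibbons-Hawking form with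
   K = d/dT exists there. *)
Definition regular_domain (C : numClosedFieldType) (k : nat) (a : C) :
    set 'rV[C]_4 :=
  [set x : 'rV[C]_4 | x 0 0 != 0 /\ normal_bundle_splits k a (curveQ k x) 1 1].

(** * Tensor calculus in coordinates *)

Definition pd (C : numClosedFieldType) (n : nat) (i : 'I_n) (f : 'rV[C]_n -> C)
    (x : 'rV[C]_n) : C :=
  'D_(delta_mx 0 i) f x.

Definition holomorphic_at (C : numClosedFieldType) (n : nat) (f : 'rV[C]_n -> C)
    (x : 'rV[C]_n) : Prop :=
  differentiable f x.

(* (i, j) entry: derivative of the j-th component in the i-th direction. *)
Definition jac (C : numClosedFieldType) (n m : nat) (F : 'rV[C]_n -> 'rV[C]_m)
    (x : 'rV[C]_n) : 'M[C]_(n, m) :=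
  \matrix_(i, j) pd i (fun y => F y 0 j) x.

(* christoffel g x l i j is Gamma^l_ij. *)
Definition christoffel (C : numClosedFieldType) (n : nat)
    (g : 'rV[C]_n -> 'M[C]_n) (x : 'rV[C]_n) (l i j : 'I_n) : C :=
  2^-1 * \sum_(m < n) invmx (g x) l m *
    (pd i (fun y => g y m j) x + pd j (fun y => g y m i) x
     - pd m (fun y => g y i j) x).

Definition ricci (C : numClosedFieldType) (n : nat) (g : 'rV[C]_n -> 'M[C]_n)
    (x : 'rV[C]_n) (i j : 'I_n) : C :=
  \sum_(l < n) (pd l (fun y => christoffel g y l i j) x
                - pd j (fun y => christoffel g y l i l) x)
  + \sum_(l < n) \sum_(m < n)
      (christoffel g x l l m * christoffel g x m i j
       - christoffel g x l j m * christoffel g x m i l).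

(* The Levi-Civita derivative of the covariant 2-tensor S vanishes at x. *)
Definition parallel_at (C : numClosedFieldType) (n : nat)
    (g S : 'rV[C]_n -> 'M[C]_n) (x : 'rV[C]_n) : Prop :=
  forall i j l : 'I_n,
    pd i (fun y => S y j l) x
    - \sum_(m < n) christoffel g x m i j * S x m l
    - \sum_(m < n) christoffel g x m i l * S x j m = 0.

(* Lie derivative of a covariant 2-tensor along the vector field K. *)
Definition lie (C : numClosedFieldType) (n : nat) (K : 'rV[C]_n -> 'rV[C]_n)
    (S : 'rV[C]_n -> 'M[C]_n) (x : 'rV[C]_n) : 'M[C]_n :=
  \matrix_(i, j) \sum_(l < n)
    (K x 0 l * pd l (fun y => S y i j) x
     + S x l j * pd i (fun y => K y 0 l) x
     + S x i l * pd j (fun y => K y 0 l) x).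

Definition ext_d (C : numClosedFieldType) (n : nat) (A : 'rV[C]_n -> 'rV[C]_n)
    (x : 'rV[C]_n) : 'M[C]_n :=
  \matrix_(i, j) (pd i (fun y => A y 0 j) x - pd j (fun y => A y 0 i) x).

Definition grad (C : numClosedFieldType) (n : nat) (f : 'rV[C]_n -> C)
    (x : 'rV[C]_n) : 'rV[C]_n :=
  \row_i pd i f x.

(* Levi-Civita symbol: the product of differences takes the values 0, 2, -2. *)
Definition eps3 (C : numClosedFieldType) (i j l : 'I_3) : C :=
  (j%:R - i%:R) * (l%:R - j%:R) * (l%:R - i%:R) / 2.

(* Hodge star of a 2-form F for the metric h with volume form
   vol * dX /\ dY /\ dZ, i.e. (star F)_i = 1/2 vol eps_ijl F^jl. *)
Definition hodge (C : numClosedFieldType) (h : 'M[C]_3) (vol : C) (F : 'M[C]_3) :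
    'rV[C]_3 :=
  \row_i (2^-1 * vol * \sum_(j < 3) \sum_(l < 3)
            eps3 C i j l * (invmx h *m F *m (invmx h)^T) j l).

(** * The metric of the twistor space *)

(* Variation of a coefficientwise family of polynomials of degree at most k. *)
Definition variation (C : numClosedFieldType) (k : nat)
    (P : 'rV[C]_4 -> {poly C}) (x v : 'rV[C]_4) : {poly C} :=
  \poly_(j < k.+1) 'D_v (fun y => (P y)`_j) x.

Definition dQ (C : numClosedFieldType) (k : nat) : 'rV[C]_4 -> 'rV[C]_4 -> {poly C} :=
  variation k (curveQ k).
Definition dQt (C : numClosedFieldType) (k : nat) : 'rV[C]_4 -> 'rV[C]_4 -> {poly C} :=
  variation k (fun y => lineQt k (curveQ k y)).
Definition dtau (C : numClosedFieldType) (k : nat) (a : C) :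
    'rV[C]_4 -> 'rV[C]_4 -> {poly C} :=
  variation k (fun y => linetau k a (curveQ k y)).
Definition dtaut (C : numClosedFieldType) (k : nat) (a : C) :
    'rV[C]_4 -> 'rV[C]_4 -> {poly C} :=
  variation k (fun y => linetaut a (curveQ k y)).

(* The section of the normal bundle defined by v vanishes at a point of CP^1.
   The chart lambda only matters for the point lambda = 0. *)
Definition null_vector (C : numClosedFieldType) (k : nat) (a : C)
    (x v : 'rV[C]_4) : Prop :=
  (exists l : C, (dQt k x v).[l] = 0 /\ (dtaut k a x v).[l] = 0) \/
  (exists l : C, (dQ k x v).[l] = 0 /\ (dtau k a x v).[l] = 0).

(* dQt /\ dtaut, pulled back to the moduli space, is
   Sigma_0 + lambda~ Sigma_1 + lambda~^2 Sigma_2. *)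
Definition Sigma (C : numClosedFieldType) (k : nat) (a : C) (n : nat)
    (x : 'rV[C]_4) : 'M[C]_4 :=
  \matrix_(i, j)
    (dQt k x (delta_mx 0 i) * dtaut k a x (delta_mx 0 j)
     - dQt k x (delta_mx 0 j) * dtaut k a x (delta_mx 0 i))`_n.

(* g is a Ricci-flat metric in the conformal class, for which the two-forms
   Sigma_0, Sigma_1, Sigma_2 are parallel.  This fixes g up to a constant: on the
   connected set regular_domain, two such metrics are constant multiples of each
   other. *)
Record twistor_metric (C : numClosedFieldType) (k : nat) (a : C)
    (g : 'rV[C]_4 -> 'M[C]_4) : Prop := TwistorMetric {
  twistor_metric_hol : forall x, regular_domain k a x ->
    forall i j, holomorphic_at (fun y => g y i j) x;
  twistor_metric_sym : forall x, regular_domain k a x -> (g x)^T = g x;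
  twistor_metric_unit : forall x, regular_domain k a x -> g x \in unitmx;
  twistor_metric_null : forall x, regular_domain k a x ->
    forall v : 'rV[C]_4, v *m g x *m v^T = 0 <-> null_vector k a x v;
  twistor_metric_ricci : forall x, regular_domain k a x ->
    forall i j, ricci g x i j = 0;
  twistor_metric_parallel : forall x, regular_domain k a x ->
    forall n : nat, (n < 3)%N -> parallel_at g (Sigma k a n) x
}.

(* K = d/dx_k *)
Definition Kfield (C : numClosedFieldType) : 'rV[C]_4 -> 'rV[C]_4 :=
  fun _ => delta_mx 0 3.

(** * Gibbons-Hawking form *)

(* Base and fibre indices: the coordinates are (X, Y, Z, T). *)
Definition XYZ (C : numClosedFieldType) (y : 'rV[C]_4) : 'rV[C]_3 :=
  \row_(i < 3) y 0 (widen_ord (leqnSn 3) i).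

Definition h_flat (C : numClosedFieldType) (c : C) : 'M[C]_3 :=
  c *: diag_mx (\row_(i < 3) (if i == 0 then 1 else -1)).

(* V h + V^-1 (dT + A)^2 in the coordinates (X, Y, Z, T) *)
Definition gibbons_hawking (C : numClosedFieldType) (h : 'M[C]_3) (V : C)
    (A : 'rV[C]_3) : 'M[C]_4 :=
  let theta : 'rV[C]_(3 + 1) := row_mx A 1%:M in
  V *: (block_mx h 0 0 0 : 'M[C]_(3 + 1)) + V^-1 *: (theta^T *m theta).

Definition quadric (C : numClosedFieldType) (w : 'rV[C]_3) (l : C) : C :=
  l ^+ 2 * (w 0 0 - w 0 1) + 2 * l * w 0 2 + (w 0 0 + w 0 1).

(* r is a holomorphic branch of (X + Y)^(1/2) on W, and s w, defined near
   lambda = 0, is the branch of quadric^(-1/2) with s w 0 = 1 / r w. *)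
Definition sqrt_branch (C : numClosedFieldType) (W : set 'rV[C]_3)
    (r : 'rV[C]_3 -> C) (s : 'rV[C]_3 -> C -> C) : Prop :=
  forall w, W w ->
    [/\ holomorphic_at r w,
        r w ^+ 2 = w 0 0 + w 0 1,
        s w 0 = (r w)^-1 &
        \forall l \near (0 : C),
          derivable (s w) l 1 /\ s w l ^+ 2 * quadric w l = 1].

Definition GH_potential (C : numClosedFieldType) (k : nat) (f : C -> C) : C :=
  (2 * ((k - 1)`!)%:R)^-1 * derive1n (k - 1) f 0.

(* Main.v *)
Require Import Defs.
From HB Require Import structures.
From mathcomp Require Import all_boot all_order all_algebra.
From mathcomp Require Import all_classical all_reals all_analysis.
From mathcomp Require Import complex.
From mathcomp Require Import zify ring.

Set Implicit Arguments.
Unset Strict Implicit.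
Unset Printing Implicit Defensive.

Import Order.TTheory GRing.Theory Num.Theory.
Import numFieldNormedType.Exports.

Local Open Scope classical_set_scope.
Local Open Scope ring_scope.

(** Write q = q_0 + q_1 l + q_2 l^2 for the part of Q^2 of degree at most 2.  The
    equations defining the twistor lines say that Q^2 = q modulo l^k, so that,
    modulo l^k, 1/Q is the Taylor polynomial S = s_0 + s_1 l + ... of
    q^(-1/2) (isqrt_inverse, curveQ_inv), and dQ = S dq / 2 up to terms in l^k
    and l^(k+1) (dQ_eq).  In the chart at infinity the second component of a
    section of the normal bundle is a l^-2 dq.  Eliminating l from dq = 0 and
    dQ = 0 leaves one quadratic equation,

      V (dq_0 dq_2 - dq_1^2 / 4) + theta^2 / V = 0,    V = s_(k-1) / 2,
      theta = dx_k - s_(k-1) dq_1 / 4 - s_(k-2) dq_2 / 2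

    (null_vector_coframe), whose left side is l_0 l_3 - l_1 l_2 for an explicit
    coframe l_0, ..., l_3.  With X + Y, 2 Z, X - Y proportional to q_0, q_1, q_2
    this is a Gibbons-Hawking metric, and V is the (k-1)-st Taylor coefficient of
    q^(-1/2) / 2, which is the potential of the theorem (derive1n_isqrt).

    The normal bundle is O(1) + O(1) exactly when V does not vanish: frames are
    built from S if V is non-zero, and otherwise S gives a section with a double
    zero (regular_domainP).

    A symmetric form that vanishes on a non-degenerate quadric is a multiple of
    the equation of the quadric (quadric_eq0), so g = f (l_0 l_3 - l_1 l_2) for a
    function f.  The form Sigma_1 is a (l_0 /\ l_3 - l_1 /\ l_2), with constant
    coefficients in the same coframe; comparing the covariant derivatives of g and
    of Sigma_1 gives df = 0 (pd_conformal_factor).  The regular domain is the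
    complement of an algebraic hypersurface, in which any two points are joined by
    a real curve inside a complex line, so f is a constant m
    (constant_on_regular_domain).  Nothing in the coframe depends on x_k, which
    makes K Killing and tri-holomorphic (killing, triholomorphic).

    The constant m is absorbed into the coordinates.  As V is homogeneous of degree
    -1/2, scaling X, Y, Z by m^2 divides V by m, and the metric takes the
    Gibbons-Hawking form with flat metric of scale m^-2 and the coordinate x_k as T
    (metric_gh_chart).  The monopole equation holds because the coefficients of
    q^(-1/2) satisfy ds_(n+1)/dq_(i+1) = ds_n/dq_i (monopole), and r is the branch
    of (X + Y)^(1/2) that equals m x_0. *)

(** * Power series of the inverse square root of a quadratic *)

Section TruncatedSeries.
Variable F : numFieldType.
Implicit Types (p q S : {poly F}) (t u b c : F) (n N : nat).

Lemma dvdXnP n p : reflect (forall i, (i < n)%N -> p`_i = 0) ('X^n %| p).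
Proof.
apply: (iffP idP) => [/dvdpP[q ->] i ilt|h]; first by rewrite coefMXn ilt.
rewrite -(poly_take_drop n p) dvdp_add ?dvdp_mull //.
by rewrite (_ : take_poly n p = 0) ?dvdp0 //; apply/polyP => i; rewrite coef_take_poly coef0; case: ifP => // /h.
Qed.

Lemma dvdXn_eqP n p q :
  reflect (forall i, (i < n)%N -> p`_i = q`_i) ('X^n %| p - q).
Proof.
apply: (iffP (dvdXnP _ _)) => h i /h; rewrite coefB.
  by move/eqP; rewrite subr_eq0 => /eqP.
by move=> ->; rewrite subrr.
Qed.

Lemma dvdXn_cancel n p q : q`_0 != 0 -> 'X^n %| p * q -> 'X^n %| p.
Proof.
move=> nz_q; rewrite Gauss_dvdpl // coprimep_expl // -['X]subr0 -polyC0.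
by rewrite coprimep_sym coprimep_XsubC rootE horner_coef0.
Qed.

Lemma dvdXn_deriv n p : p`_0 = 0 -> 'X^n %| p^`() -> 'X^(n.+1) %| p.
Proof.
move=> p0 /dvdXnP h; apply/dvdXnP => -[//|i] /h.
by rewrite coef_deriv => /eqP; rewrite mulrn_eq0 /= => /eqP.
Qed.

Definition quad (u b c : F) : {poly F} := u%:P + b *: 'X + c *: 'X^2.

Lemma coef_quadM u b c p n :
  (quad u b c * p)`_n =
  u * p`_n + b * (if n is m.+1 then p`_m else 0)
  + c * (if n is m.+2 then p`_m else 0).
Proof.
rewrite /quad !mulrDl !coefD coefCM -!scalerAl !coefZ coefXM coefXnM.
by case: n => [|[|n]] //=; rewrite subn2.
Qed.

Lemma coef_quad u b c n : (quad u b c)`_n = [:: u; b; c]`_n.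
Proof.
rewrite -[quad _ _ _]mulr1 coef_quadM !coef1.
by case: n => [|[|[|n]]] /=; rewrite ?nth_nil ?coef1 /= ?mulr0 ?mulr1 ?addr0 ?add0r.
Qed.

Lemma horner_quad u b c (l : F) : (quad u b c).[l] = u + b * l + c * l ^+ 2.
Proof. by rewrite !hornerE. Qed.

Lemma deriv_quad u b c : (quad u b c)^`() = quad b (2 * c) 0.
Proof.
apply/polyP => n; rewrite coef_deriv !coef_quad.
case: n => [|[|[|n]]] /=; rewrite ?nth_nil ?mul0rn //.
by rewrite mulr_natl.
Qed.

(** Taylor coefficients of (t^-2 + b l + c l^2)^(-1/2), in pairs (s_n, s_(n-1)),
    by the three-term recurrence of the Legendre polynomials. *)
Fixpoint isqrt_pair t b c n : F * F :=
  if n is m.+1 then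
    let: (u, v) := isqrt_pair t b c m in
    (- t ^+ 2 * ((m%:R + 2^-1) * b * u + m%:R * c * v) / m.+1%:R, u)
  else (t, 0).

Definition isqrt_coef t b c n : F := (isqrt_pair t b c n).1.

Lemma isqrt_coef0 t b c : isqrt_coef t b c 0 = t.
Proof. by []. Qed.

Lemma isqrt_coefS t b c n :
  isqrt_coef t b c n.+1 =
  - t ^+ 2 * ((n%:R + 2^-1) * b * isqrt_coef t b c n
              + n%:R * c * isqrt_coef t b c n.-1) / n.+1%:R.
Proof.
rewrite /isqrt_coef /=; case E: isqrt_pair => [u v] /=.
case: n E => [|n] /= E; first by rewrite !mul0r.
by move: E; case: isqrt_pair => u' v' /= [_ <-].
Qed.

Definition isqrt t b c N : {poly F} := \poly_(n < N) isqrt_coef t b c n.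

(** Coefficient by coefficient, the recurrence is the differential equation
    2 q S' + q' S = 0 of S = q^(-1/2). *)
Lemma isqrt_ode t b c N S : t != 0 ->
  (forall i, (i <= N)%N -> S`_i = isqrt_coef t b c i) ->
  'X^N %| 2 *: (quad (t ^- 2) b c * S^`()) + (quad (t ^- 2) b c)^`() * S.
Proof.
move=> t0 Sj; apply/dvdXnP => j jN; rewrite coefD coefZ deriv_quad !coef_quadM.
rewrite coef_deriv (Sj _ jN) (Sj _ (ltnW jN)) isqrt_coefS -[_ *+ j.+1]mulr_natr.
case: j jN => [|j] jN; first by rewrite /=; field.
have Sj' : (if j is m.+1 then (S^`())`_m else 0) = j%:R * isqrt_coef t b c j.
  case: j jN => [|j] jN; first by rewrite mul0r.
  by rewrite coef_deriv Sj ?mulr_natl //; lia.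
rewrite Sj' coef_deriv !Sj; try lia.
rewrite [j.+1.-1]/= -[_ *+ j.+1]mulr_natr.
have : j.+2%:R != 0 :> F by rewrite pnatr_eq0.
by rewrite -!natr1 => j3; field; rewrite j3.
Qed.

(** The derivative of S^2 q is S (2 q S' + q' S), so S^2 q is constant to the
    order considered. *)
Lemma isqrt_sq t b c N : t != 0 ->
  'X^N %| isqrt t b c N ^+ 2 * quad (t ^- 2) b c - 1.
Proof.
move=> t0; case: N => [|N]; first by rewrite expr0 dvd1p.
have Sj i : (i <= N)%N -> (isqrt t b c N.+1)`_i = isqrt_coef t b c i.
  by move=> iN; rewrite coef_poly ltnS iN.
have := isqrt_ode t0 Sj; have := Sj 0%N isT.
move: (isqrt t b c N.+1) => S {Sj} S0 ode.
apply: dvdXn_deriv.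
  by rewrite coefB coef1 mulrC coef_quadM coef0M S0 isqrt_coef0 /=; field.
rewrite derivB derivC subr0 expr2 !derivM.
rewrite (_ : _ + _ = S * (2 *: (quad (t ^- 2) b c * S^`()) + (quad (t ^- 2) b c)^`() * S)).
  by rewrite dvdp_mull.
by rewrite scaler_nat; ring.
Qed.

Lemma dvdXn_sqr1 n p : p`_0 = 1 -> 'X^n %| p ^+ 2 - 1 -> 'X^n %| p - 1.
Proof.
move=> p0; rewrite (_ : _ - 1 = (p - 1) * (p + 1)); last by ring.
by apply: dvdXn_cancel; rewrite coefD coef1 p0 -mulr2n pnatr_eq0.
Qed.

(** Both p and 1/S are square roots of q; their constant terms fix the sign. *)
Lemma isqrt_inverse t b c N p : t != 0 -> p`_0 = t^-1 ->
  'X^N %| p ^+ 2 - quad (t ^- 2) b c -> 'X^N %| p * isqrt t b c N - 1.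
Proof.
case: N => [|N] t0 p0 sq; first by rewrite expr0 dvd1p.
apply: dvdXn_sqr1.
  by rewrite coef0M p0 coef_poly isqrt_coef0 mulVf.
set S := isqrt _ _ _ _; set q := quad _ _ _ in sq *.
rewrite (_ : _ - 1 = S ^+ 2 * (p ^+ 2 - q) + (S ^+ 2 * q - 1)); last by ring.
by rewrite dvdp_add ?dvdp_mull // isqrt_sq.
Qed.

(** The function q^(-1/2) is homogeneous of degree -1/2 in q. *)
Lemma isqrt_coef_scale (m : F) t b c n : m != 0 ->
  isqrt_coef (t / m) (m ^+ 2 * b) (m ^+ 2 * c) n = isqrt_coef t b c n / m.
Proof.
move=> m0; elim/ltn_ind: n => -[|n] IH //.
rewrite !isqrt_coefS IH // IH; last by lia.
have n0 : n.+1%:R != 0 :> F by rewrite pnatr_eq0.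
move: n0; rewrite -natr1 => n0; field.
by rewrite n0 m0.
Qed.

End TruncatedSeries.

(** * Differential calculus of scalars, polynomials and matrices *)

Section ScalarCalculus.
Variables (K : numFieldType) (V : normedModType K).
Implicit Types (f g : V -> K) (x v : V).

Lemma is_derive_add f g x v df dg :
  is_derive x v f df -> is_derive x v g dg ->
  is_derive x v (fun y => f y + g y) (df + dg).
Proof. exact: is_deriveD. Qed.

Lemma is_derive_opp f x v df :
  is_derive x v f df -> is_derive x v (fun y => - f y) (- df).
Proof. exact: is_deriveN. Qed.

Lemma is_derive_mul f g x v df dg :
  is_derive x v f df -> is_derive x v g dg ->
  is_derive x v (fun y => f y * g y) (f x * dg + df * g x).
Proof. by move=> hf hg; rewrite [df * _]mulrC; exact: is_deriveM. Qed.

Lemma is_derive_const x v (k : K) : is_derive x v (fun=> k) 0.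
Proof. exact: is_derive_cst. Qed.

Lemma is_derive_scale (k : K) f x v df :
  is_derive x v f df -> is_derive x v (fun y => k * f y) (k * df).
Proof. exact: is_deriveZ. Qed.

Lemma is_derive_inv f x v df : f x != 0 ->
  is_derive x v f df -> is_derive x v (fun y => (f y)^-1) (- (f x) ^- 2 * df).
Proof.
move=> fx0 [hf <-]; apply: DeriveDef; first exact: derivableV.
by rewrite deriveV.
Qed.

Lemma is_derive_bigsum n (h : 'I_n -> V -> K) x v (dh : 'I_n -> K) :
  (forall i, is_derive x v (h i) (dh i)) ->
  is_derive x v (fun y => \sum_(i < n) h i y) (\sum_(i < n) dh i).
Proof.
move=> hh; have := is_derive_sum hh.
by congr (is_derive _ _ _ _); apply/funext => y; rewrite fct_sumE.
Qed.

Lemma differentiable_add f g x : differentiable f x -> differentiable g x ->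
  differentiable (fun y => f y + g y) x.
Proof. exact: differentiableD. Qed.

Lemma differentiable_opp f x : differentiable f x ->
  differentiable (fun y => - f y) x.
Proof. exact: differentiableN. Qed.

Lemma differentiable_mul f g x : differentiable f x -> differentiable g x ->
  differentiable (fun y => f y * g y) x.
Proof. exact: differentiableM. Qed.

Lemma differentiable_const x (k : K) : differentiable (fun=> k) x.
Proof. exact: differentiable_cst. Qed.

Lemma differentiable_exp f x n : differentiable f x ->
  differentiable (fun y => f y ^+ n) x.
Proof.
move=> df; elim: n => [|n IH]; first exact: differentiable_const.
have -> : (fun y => f y ^+ n.+1) = (fun y => f y * f y ^+ n).
  by apply/funext => y; rewrite exprS.
exact: differentiable_mul.
Qed.

Lemma differentiable_bigsum (I : Type) (r : seq I) (P : pred I) (h : I -> V -> K) x :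
  (forall i, P i -> differentiable (h i) x) ->
  differentiable (fun y => \sum_(i <- r | P i) h i y) x.
Proof.
move=> hh; have -> : (fun y => \sum_(i <- r | P i) h i y) = \sum_(i <- r | P i) h i.
  by apply/funext => y; rewrite fct_sumE.
elim/big_ind: _ => [|f g df dg|i /hh //]; [exact: differentiable_cst|exact: differentiableD].
Qed.

(** Gives derivability and the value of the derivative at once. *)
Lemma is_derive_slope (s : K -> K) f x v df :
  (\forall h \near 0^', h^-1 * (f (h *: v + x) - f x) = s h) ->
  s @ 0^' --> df -> is_derive x v f df.
Proof.
move=> fs sl.
have C : (fun h => h^-1 *: ((f \o shift x) (h *: v) - f x)) @ 0^' --> df.
  apply: cvg_trans sl; apply: near_eq_cvg.
  by near=> h; rewrite /= -(near fs h).
apply: DeriveDef; first by apply/cvg_ex; exists df.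
exact: cvg_lim C.
Unshelve. all: by end_near. Qed.

Lemma is_derive_const_along f x v :
  (\forall h \near (0 : K), f (h *: v + x) = f x) -> is_derive x v f 0.
Proof.
move=> fc; apply: (@is_derive_slope (cst 0)) (cvg_cst 0).
by apply: cvg_within; near=> h; rewrite (near fc h) // subrr mulr0.
Unshelve. all: by end_near. Qed.

End ScalarCalculus.

Lemma is_derive_coord (K : numFieldType) m n (x v : 'M[K]_(m, n)) i j :
  is_derive x v (fun y : 'M[K]_(m, n) => y i j) (v i j).
Proof.
apply: (@is_derive_slope _ _ (cst (v i j))) (cvg_cst _).
near=> h; rewrite !mxE addrK mulKf //.
by near: h; exact: nbhs_dnbhs_neq.
Unshelve. all: by end_near. Qed.

Section PolynomialFamilies.
Variables (K : numFieldType) (V : normedModType K).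
Implicit Types (p q : V -> {poly K}) (x v : V).

(** Coefficientwise, in agreement with variation. *)
Definition is_poly_derive x v p (dp : {poly K}) : Prop :=
  forall i, is_derive x v (fun y => (p y)`_i) dp`_i.

Lemma is_poly_derive_mul x v p q dp dq :
  is_poly_derive x v p dp -> is_poly_derive x v q dq ->
  is_poly_derive x v (fun y => p y * q y) (p x * dq + dp * q x).
Proof.
move=> hp hq i; rewrite coefD !coefM -big_split /=.
under eq_fun do rewrite coefM.
apply: is_derive_bigsum => j; exact: is_derive_mul (hp j) (hq _).
Qed.

Lemma is_poly_derive_poly x v n (f : nat -> V -> K) (df : nat -> K) :
  (forall i, (i < n)%N -> is_derive x v (f i) (df i)) ->
  is_poly_derive x v (fun y => \poly_(i < n) f i y) (\poly_(i < n) df i).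
Proof.
move=> hf i; rewrite coef_poly; under eq_fun do rewrite coef_poly.
by case: ifP => [/hf //|_]; exact: is_derive_const.
Qed.

Lemma is_poly_derive_quad x v (u b c : V -> K) (du db dc : K) :
  is_derive x v u du -> is_derive x v b db -> is_derive x v c dc ->
  is_poly_derive x v (fun y => quad (u y) (b y) (c y)) (quad du db dc).
Proof.
move=> hu hb hc i; rewrite coef_quad; under eq_fun do rewrite coef_quad.
case: i => [|[|[|i]]] //=; rewrite nth_nil.
exact: is_derive_const.
Qed.

(** Congruences modulo X^n are identities between coefficients, so they may be
    differentiated in a parameter. *)
Lemma is_poly_derive_mod x v p q dp dq n :
  is_poly_derive x v p dp -> is_poly_derive x v q dq ->
  (\forall y \near x, 'X^n %| p y - q y) -> 'X^n %| dp - dq.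
Proof.
move=> hp hq pq; apply/dvdXn_eqP => i i_n.
have [hpi hqi] := (hp i, hq i).
rewrite -(@derive_val _ _ _ _ _ _ _ hpi) -(@derive_val _ _ _ _ _ _ _ hqi).
apply: near_eq_derive; near=> y.
by have /dvdXn_eqP -> // : 'X^n %| p y - q y by near: y.
Unshelve. all: by end_near. Qed.

End PolynomialFamilies.

(** * Inverse square roots and square root branches *)

Section InverseSquareRootCalculus.
Variables (K : numFieldType) (V : normedModType K).

Lemma differentiable_isqrt_coef (t b c : V -> K) (x : V) n :
  differentiable t x -> differentiable b x -> differentiable c x ->
  differentiable (fun y => isqrt_coef (t y) (b y) (c y) n) x.
Proof.
move=> dt db dc; elim/ltn_ind: n => -[|n] IH //.
under eq_fun do rewrite isqrt_coefS.
have dk (k : K) f : differentiable f x -> differentiable (fun y => k * f y) x.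
  by move=> df; apply: differentiable_mul df; exact: differentiable_const.
have dbk (k : K) : differentiable (fun y : V => k * b y) x by exact: dk.
have dck (k : K) : differentiable (fun y : V => k * c y) x by exact: dk.
apply: differentiable_mul; last exact: differentiable_const.
apply: differentiable_mul.
  exact/differentiable_opp/differentiable_exp.
apply: differentiable_add; apply: differentiable_mul => //; apply: IH => //.
by case: n.
Qed.

(** Along the curve l |-> q(l)^(-1/2) the Taylor coefficients of the shifted
    series are successive derivatives divided by factorials; the curve enters
    only through the ordinary differential equation of q(l)^(-1/2). *)
Lemma is_derive_isqrt_coef (s b : K -> K) (c l : K) n :
  is_derive l 1 s (- 2^-1 * b l * s l ^+ 3) -> is_derive l 1 b (2 * c) ->
  is_derive l 1 (fun l => isqrt_coef (s l) (b l) c n)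
    (n.+1%:R * isqrt_coef (s l) (b l) c n.+1).
Proof.
move=> ds db; elim/ltn_ind: n => -[|n] IH.
  by apply: (is_derive_eq ds); rewrite isqrt_coefS !isqrt_coef0 /=; field.
under eq_fun do rewrite isqrt_coefS.
have dpred : is_derive l 1 (fun l => n%:R * c * isqrt_coef (s l) (b l) c n.-1)
    (n%:R * c * (n%:R * isqrt_coef (s l) (b l) c n)).
  case: n IH => [|n] IH; last by apply: is_derive_scale; apply: IH.
  under eq_fun do rewrite !mul0r.
  by rewrite !mul0r; exact: is_derive_const.
have dn := IH n (ltnSn n).
have d2 := is_derive_opp (is_derive_mul ds ds).
have d3 := is_derive_mul (is_derive_scale (n%:R + 2^-1) db) dn.
have d := is_derive_mul (is_derive_mul d2 (is_derive_add d3 dpred))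
            (is_derive_const l 1 n.+1%:R^-1).
have n1 : n.+1%:R != 0 :> K by rewrite pnatr_eq0.
have n2 : n.+2%:R != 0 :> K by rewrite pnatr_eq0.
apply: (is_derive_eq d).
rewrite !(isqrt_coefS _ _ _ n.+1, isqrt_coefS _ _ _ n) [n.+1.-1]/=.
move: (isqrt_coef _ _ _ n) (isqrt_coef _ _ _ n.-1) n1 n2 => u u'.
rewrite -[n.+2%:R]natr1 -[n.+1%:R]natr1 => n1 n2.
by field; rewrite n1 n2.
Qed.

Lemma derive1n_isqrt (O : set K) (s : K -> K) (b c : K) n :
  open O -> (forall l, O l -> is_derive l 1 s (- 2^-1 * (b + 2 * c * l) * s l ^+ 3)) ->
  forall l, O l -> derive1n n s l = n`!%:R * isqrt_coef (s l) (b + 2 * c * l) c n.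
Proof.
move=> oO ds; elim: n => [|n IH] l Ol; first by rewrite derive1n0 fact0 mul1r.
rewrite derive1nS derive1E.
have db : is_derive l 1 (fun l => b + 2 * c * l) (2 * c).
  have d := is_derive_add (is_derive_const l 1 b)
    (is_derive_scale (2 * c) (is_derive_id l (1 : K))).
  by apply: (is_derive_eq d); rewrite add0r mulr1.
have dn := is_derive_scale n`!%:R (is_derive_isqrt_coef n (ds l Ol) db).
rewrite (near_eq_derive (g := fun l => n`!%:R * isqrt_coef (s l) (b + 2 * c * l) c n)).
  by rewrite derive_val factS natrM mulrCA mulrA.
by near=> l'; apply: IH; near: l'; exact: open_nbhs_nbhs.
Unshelve. all: by end_near. Qed.

End InverseSquareRootCalculus.

Section SquareRootBranch.
Variable C : numClosedFieldType.
Implicit Types r u z : C.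

(** The square root of u nearer to r: a holomorphic function of u wherever one
    root is strictly nearer than the other. *)
Definition near_sqrt r u : C :=
  let z := sqrtC u in if `|z - r| <= `|z + r| then z else - z.

Lemma near_sqrt_sq r u : near_sqrt r u ^+ 2 = u.
Proof. by rewrite /near_sqrt /=; case: ifP => _; rewrite ?sqrrN sqrtCK. Qed.

Lemma near_sqrt_le r u : `|near_sqrt r u - r| <= `|near_sqrt r u + r|.
Proof.
rewrite /near_sqrt /=; case: ifP => // /negbT.
rewrite -real_ltNge ?normr_real // => /ltW.
by rewrite -opprD normrN [- _ + _]addrC [`|r - _|]distrC.
Qed.

Lemma near_sqrt_uniq r u z : z ^+ 2 = u -> `|z - r| < `|z + r| ->
  near_sqrt r u = z.
Proof.
move=> zu zr; have /eqP := near_sqrt_sq r u.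
rewrite -zu eqf_sqr => /orP[/eqP //|/eqP e].
have := near_sqrt_le r (z ^+ 2); rewrite e.
by rewrite -opprD normrN [- _ + _]addrC [`|r - _|]distrC lt_geF.
Qed.

Lemma near_sqrt_neq0 r u : `|near_sqrt r u - r| < `|near_sqrt r u + r| ->
  near_sqrt r u != 0.
Proof.
by apply: contraTneq => ->; rewrite sub0r add0r normrN ltxx.
Qed.

(** If z and z' are the chosen roots of u and u' then (z' - z)(z' + z) = u' - u,
    so z' is close to z or to -z; the latter is excluded because -z is strictly
    farther from r than z. *)
Lemma near_sqrt_lipschitz r u : let z := near_sqrt r u in `|z - r| < `|z + r| ->
  \forall u' \near u,
    `|z| <= `|near_sqrt r u' + z| /\ `|near_sqrt r u' - z| <= `|u' - u| / `|z|.
Proof.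
move=> z zr; have z0 : 0 < `|z| by rewrite normr_gt0 near_sqrt_neq0.
(* 2 d is by how much -z is farther from r than z.  If |u' - u| < d^2 then
   |z' - z| < d or |z' + z| < d, and the second would make z' farther from r
   than -z'. *)
pose d := (`|z + r| - `|z - r|) / 2.
have d0 : 0 < d by rewrite divr_gt0 // subr_gt0.
have dz : d <= `|z|.
  rewrite ler_pdivrMr // lerBlDr mulr_natr mulr2n.
  have -> : z + r = z + z - (z - r) by ring.
  by rewrite (le_trans (ler_normB _ _)) // lerD2r ler_normD.
near=> u'; set z' := near_sqrt r u'.
have uu : `|u' - u| < d * d.
  by rewrite distrC; near: u'; apply: nbhsx_ballx; exact: mulr_gt0.
have zz : `|z' - z| * `|z' + z| = `|u' - u|.
  by rewrite -normrM -subr_sqr !near_sqrt_sq.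
have zd : `|z' - z| < d.
  rewrite real_ltNge ?normr_real ?gtr0_real //; apply/negP => dz'.
  have zd' : `|z' + z| < d.
    rewrite real_ltNge ?normr_real ?gtr0_real //; apply/negP => dz''.
    by have := lt_geF uu; rewrite -zz ler_pM // ltW.
  have := near_sqrt_le r u'; rewrite -/z' => h.
  have h1 : `|z + r| <= `|z' + z| + `|z' - r|.
    by rewrite -[z + r](_ : (z' + z) - (z' - r) = _) ?ler_normB //; ring.
  have h2 : `|z' + r| <= `|z' + z| + `|z - r|.
    by rewrite -[z' + r](_ : (z' + z) - (z - r) = _) ?ler_normB //; ring.
  have := le_trans h1 (lerD (lexx _) (le_trans h h2)).
  rewrite addrA -lerBlDr -[_ - _](@divfK _ 2) ?pnatr_eq0 // -/d.
  rewrite mulr_natr mulr2n => /le_lt_trans.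
  by move=> /(_ _ (ltrD zd' zd')); rewrite ltxx.
have zl : `|z| <= `|z' + z|.
  have -> : z' + z = z + z - (z - z') by ring.
  apply: le_trans (lerB_dist _ _); rewrite distrC -mulr2n normrMn mulr2n.
  by rewrite -[leLHS]addr0 lerBrDr -addrA lerD2l add0r (le_trans (ltW zd)).
split=> //; rewrite ler_pdivlMr // -zz ler_wpM2l //.
Unshelve. all: by end_near. Qed.

Lemma near_sqrt_continuous r u : `|near_sqrt r u - r| < `|near_sqrt r u + r| ->
  near_sqrt r @ u --> near_sqrt r u.
Proof.
move=> zr; have z0 := near_sqrt_neq0 zr; have lip := near_sqrt_lipschitz zr.
apply/(@cvgrPdist_lt _ _ _ (nbhs u)) => e e0; near=> u'.
have [//|_] := near lip u'; rewrite distrC => /le_lt_trans; apply.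
rewrite ltr_pdivrMr ?normr_gt0 // distrC; near: u'.
by apply: nbhsx_ballx; rewrite mulr_gt0 ?normr_gt0.
Unshelve. all: by end_near. Qed.

Lemma near_sqrt_near r u : `|near_sqrt r u - r| < `|near_sqrt r u + r| ->
  \forall u' \near u, `|near_sqrt r u' - r| < `|near_sqrt r u' + r|.
Proof.
move=> zr; have cz := near_sqrt_continuous zr.
set z := near_sqrt r u in zr cz.
(* within e of z the root z' stays strictly nearer to r than -z' *)
pose e := (`|z + r| - `|z - r|) / 2.
have e0 : 0 < e by rewrite divr_gt0 // subr_gt0.
have eE : `|z - r| + e = `|z + r| - e.
  by rewrite /e; field.
have /cvgrPdist_lt/(_ _ e0) ze := cz.
near=> u'.
have zz : `|z - near_sqrt r u'| < e by near: u'.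
set z' := near_sqrt r u' in zz *.
have h1 : `|z' - r| <= `|z - r| + `|z - z'|.
  by rewrite -[z' - r](_ : (z - r) - (z - z') = _) ?ler_normB //; ring.
have h2 : `|z + r| - `|z - z'| <= `|z' + r|.
  by rewrite -[z' + r](_ : (z + r) - (z - z') = _) ?lerB_dist //; ring.
apply: le_lt_trans h1 (lt_le_trans _ h2).
rewrite (@lt_trans _ _ (`|z - r| + e)) ?ltrD2l // eE ltrD2l ltrN2 //.
Unshelve. all: by end_near. Qed.

(** The difference quotient of the square root is 1 / (z' + z). *)
Lemma is_derive_near_sqrt r u : `|near_sqrt r u - r| < `|near_sqrt r u + r| ->
  is_derive u 1 (near_sqrt r) (2 * near_sqrt r u)^-1.
Proof.
move=> zr; have z0 := near_sqrt_neq0 zr; have cz := near_sqrt_continuous zr.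
have lip := near_sqrt_lipschitz zr.
set z := near_sqrt r u in z0 lip *.
have sh : (fun h : C => h + u) @ 0^' --> u.
  rewrite -[X in _ --> X]add0r; apply: cvgD; last exact: cvg_cst.
  exact: nbhs_dnbhs.
have lip0 : \forall h \near 0^', near_sqrt r (h + u) + z != 0.
  apply: (sh (fun u' => near_sqrt r u' + z != 0)).
  near=> u'; have [+ _] : `|z| <= `|near_sqrt r u' + z| /\
      `|near_sqrt r u' - z| <= `|u' - u| / `|z| by near: u'.
  by rewrite -!normr_gt0 => /(lt_le_trans _); apply; rewrite normr_gt0.
apply: (@is_derive_slope _ _ (fun h => (near_sqrt r (h + u) + z)^-1)).
  near=> h; rewrite /= [h *: 1]mulr1.
  have h0 : h != 0 by near: h; exact: nbhs_dnbhs_neq.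
  have zz0 : near_sqrt r (h + u) + z != 0 by near: h.
  apply: (mulfI h0); rewrite mulVKf //; apply: (mulIf zz0).
  by rewrite -subr_sqr !near_sqrt_sq addrK divfK.
apply: cvgV; first by rewrite mulf_neq0 ?pnatr_eq0.
rewrite mulr_natl mulr2n; apply: cvgD; last exact: cvg_cst.
exact: cvg_comp sh cz.
Unshelve. all: by end_near. Qed.

End SquareRootBranch.

(** * Variations of the twistor curve *)

Section TwistorCurve.
Variables (C : numClosedFieldType) (k : nat).
Hypothesis k3 : (3 <= k)%N.
Implicit Types (x v y : 'rV[C]_4).

(** The coefficients q_0, q_1, q_2 of Q^2, in the coordinates x. *)
Definition sq_coef x (n : nat) : C :=
  [:: x 0 0 ^+ 2; 2 * x 0 0 * x 0 1; x 0 1 ^+ 2 + 2 * x 0 0 * x 0 2]`_n.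

(** The differentials dq_0, dq_1, dq_2 at x, applied to v. *)
Definition dsq_coef x v (n : nat) : C :=
  [:: 2 * x 0 0 * v 0 0; 2 * (x 0 0 * v 0 1 + x 0 1 * v 0 0);
      2 * (x 0 1 * v 0 1 + x 0 0 * v 0 2 + x 0 2 * v 0 0)]`_n.

Definition sq_quad x : {poly C} := quad (sq_coef x 0) (sq_coef x 1) (sq_coef x 2).

Definition dsq_quad x v : {poly C} :=
  quad (dsq_coef x v 0) (dsq_coef x v 1) (dsq_coef x v 2).

(** The coefficients s_n of q^(-1/2), which for n < k are those of 1/Q. *)
Definition inv_coef x (n : nat) : C :=
  isqrt_coef (x 0 0)^-1 (sq_coef x 1) (sq_coef x 2) n.

Definition inv_poly x : {poly C} := \poly_(n < k) inv_coef x n.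

Lemma curveQ_coefs x : x 0 0 != 0 ->
  [/\ (curveQ k x)`_0 = x 0 0, (curveQ k x)`_1 = x 0 1,
      (curveQ k x)`_2 = x 0 2 & (curveQ k x)`_k = x 0 3].
Proof.
move=> x0; have [_ /rowP h] := curveQ_moduli k3 x0.
by split; [have := h 0|have := h 1|have := h 2|have := h 3]; rewrite mxE.
Qed.

Lemma curveQ_sq x : x 0 0 != 0 -> 'X^k %| curveQ k x ^+ 2 - sq_quad x.
Proof.
move=> x0; have [[_ h] _] := curveQ_moduli k3 x0.
have [e0 e1 e2 _] := curveQ_coefs x0.
apply/dvdXn_eqP => n nk; rewrite coef_quad.
case: n nk => [|[|[|n]]] nk; rewrite /= ?nth_nil.
- by rewrite expr2 coef0M e0.
- by rewrite expr2 coefM !big_ord_recl big_ord0 /= e0 e1 /sq_coef /=; ring.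
- by rewrite expr2 coefM !big_ord_recl big_ord0 /= e0 e1 e2 /sq_coef /=; ring.
by rewrite h //; lia.
Qed.

Lemma curveQ_inv x : x 0 0 != 0 -> 'X^k %| curveQ k x * inv_poly x - 1.
Proof.
move=> x0; have [e0 _ _ _] := curveQ_coefs x0.
have x0' : (x 0 0)^-1 != 0 by rewrite invr_eq0.
apply: isqrt_inverse => //; first by rewrite e0 invrK.
by rewrite exprVn invrK; exact: curveQ_sq.
Qed.

Lemma near_x0 x : x 0 0 != 0 -> \forall y \near x, (y : 'rV[C]_4) 0 0 != 0.
Proof.
move=> x0; have c := differentiable_continuous (differentiable_coord x 0 0).
exact: cvgr_neq0 c x0.
Qed.

Lemma differentiable_curveQ x n : x 0 0 != 0 ->
  differentiable (fun y => (curveQ k y)`_n) x.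
Proof.
move=> x0; under eq_fun do rewrite coef_poly.
case: (n < k.+1)%N; last exact: differentiable_const.
case: (n == k); first exact: differentiable_coord.
have [nk|kn] := ltnP n k; last first.
  under eq_fun do rewrite nth_default ?size_lowcoefs //.
  exact: differentiable_const.
elim/ltn_ind: n nk => n IH nk.
under eq_fun do rewrite lowcoefs_nth //.
case: (n < 3)%N; first exact: differentiable_coord.
apply: differentiable_mul.
  apply: differentiable_opp; under eq_fun do rewrite big_nat_cond.
  apply: differentiable_bigsum => i; rewrite andbT => /andP[i1 i_n].
  by apply: differentiable_mul; apply: IH; lia.
apply: differentiableV; last by rewrite mulf_neq0 ?pnatr_eq0.
apply: differentiable_mul; first exact: differentiable_const.
exact: differentiable_coord.
Qed.

Lemma is_poly_derive_curveQ x v : x 0 0 != 0 ->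
  is_poly_derive x v (curveQ k) (dQ k x v).
Proof.
move=> x0 n; rewrite coef_poly.
case: ltnP => nk; first by apply/derivableP/diff_derivable/differentiable_curveQ.
under eq_fun do rewrite coef_poly ltnNge nk.
exact: is_derive_const.
Qed.

Lemma is_derive_sq_coef x v n :
  is_derive x v (fun y => sq_coef y n) (dsq_coef x v n).
Proof.
have d i := is_derive_coord x v 0 i.
have d0 := is_derive_scale 2 (d 0).
case: n => [|[|[|n]]]; rewrite /sq_coef /dsq_coef /=; last first.
- by under eq_fun do rewrite nth_nil; rewrite nth_nil; exact: is_derive_const.
- have h := is_derive_add (is_derive_mul (d 1) (d 1)) (is_derive_mul d0 (d 2)).
  by apply: (is_derive_eq h); ring.
- by apply: (is_derive_eq (is_derive_mul d0 (d 1))); ring.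
- by apply: (is_derive_eq (is_derive_mul (d 0) (d 0))); ring.
Qed.

(** Differentiate Q^2 = q modulo X^k. *)
Lemma dQ_sq_mod x v : x 0 0 != 0 ->
  'X^k %| 2 *: (curveQ k x * dQ k x v) - dsq_quad x v.
Proof.
move=> x0; have dQx := is_poly_derive_curveQ v x0.
have dQQ := is_poly_derive_mul dQx dQx.
have dq : is_poly_derive x v sq_quad (dsq_quad x v).
  by apply: is_poly_derive_quad; exact: is_derive_sq_coef.
rewrite (_ : 2 *: _ = curveQ k x * dQ k x v + dQ k x v * curveQ k x); last first.
  by rewrite scaler_nat; ring.
apply: is_poly_derive_mod dQQ dq _; near=> y.
by rewrite -expr2; apply: curveQ_sq; near: y; exact: near_x0.
Unshelve. all: by end_near. Qed.

Lemma dQ_mod x v : x 0 0 != 0 ->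
  'X^k %| 2 *: dQ k x v - dsq_quad x v * inv_poly x.
Proof.
move=> x0; have h := dQ_sq_mod v x0; have h' := curveQ_inv x0.
rewrite (_ : _ - _ = inv_poly x * (2 *: (curveQ k x * dQ k x v) - dsq_quad x v)
    - 2 *: dQ k x v * (curveQ k x * inv_poly x - 1)); last by rewrite !scaler_nat; ring.
by rewrite dvdp_sub ?dvdp_mull.
Qed.

Lemma coef_quadM_ge2 (u b c : C) p n : (2 <= n)%N ->
  (quad u b c * p)`_n = u * p`_n + b * p`_(n - 1) + c * p`_(n - 2).
Proof. by rewrite coef_quadM; case: n => [|[|n]] // _; rewrite !subSS !subn0. Qed.

Lemma coef_inv_poly x n : (inv_poly x)`_n = if (n < k)%N then inv_coef x n else 0.
Proof. by rewrite coef_poly. Qed.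

(** The product S dq / 2 has degree at most k + 1.  Its coefficient of X^(k+1)
    is removed from dQ, and its coefficient of X^k is corrected to dx_k. *)
Definition last_coef x v : C :=
  v 0 3 - 2^-1 * (dsq_coef x v 1 * inv_coef x (k - 1)
                  + dsq_coef x v 2 * inv_coef x (k - 2)).

Lemma dQ_k x v : (dQ k x v)`_k = v 0 3.
Proof.
rewrite coef_poly ltnSn; under eq_fun do rewrite coef_poly ltnSn eqxx.
exact: (@derive_val _ _ _ _ _ _ _ (is_derive_coord x v 0 3)).
Qed.

Lemma dQ_eq x v : x 0 0 != 0 ->
  dQ k x v = 2^-1 *: (dsq_quad x v * inv_poly x) + last_coef x v *: 'X^k
             - (2^-1 * dsq_coef x v 2 * inv_coef x (k - 1)) *: 'X^(k.+1).
Proof.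
move=> x0; have /dvdXn_eqP dQm := dQ_mod v x0.
have n20 : 2 != 0 :> C by rewrite pnatr_eq0.
apply/polyP => n; rewrite coefB coefD !coefZ !coefXn.
case: (ltngtP n k) => nk.
- rewrite (_ : n == k.+1 = false) ?mulr0 ?addr0 ?subr0; last by lia.
  by rewrite -dQm // coefZ mulKf.
- rewrite mulr0 addr0 coef_poly ltnNge nk /=.
  have n2 : (2 <= n)%N by lia.
  rewrite coef_quadM_ge2 // !coef_inv_poly.
  rewrite (_ : (n < k)%N = false); last by lia.
  rewrite (_ : (n - 1 < k)%N = false); last by lia.
  have [->|nk1] := eqVneq n k.+1; last first.
    have -> : (n - 2 < k)%N = false by lia.
    by rewrite !mulr0 !addr0 mulr0 subr0.
  rewrite (_ : (k.+1 - 2 < k)%N); last by lia.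
  by rewrite (_ : k.+1 - 2 = k - 1)%N // mulr1; ring.
rewrite nk dQ_k coef_quadM_ge2; last by lia.
rewrite !coef_inv_poly ltnn (_ : (k - 1 < k)%N); last by lia.
rewrite (_ : (k - 2 < k)%N); last by lia.
rewrite (_ : k == k.+1 = false) ?mulr0 ?subr0 ?mulr1; last by lia.
by rewrite /last_coef; ring.
Qed.

Lemma linetaut_coef_derive (a : C) x v n : x 0 0 != 0 ->
  'D_v (fun y => (linetaut a (curveQ k y))`_n) x
  = a * [:: dsq_coef x v 2; dsq_coef x v 1; dsq_coef x v 0]`_n.
Proof.
move=> x0.
have dQx := is_poly_derive_curveQ v x0.
have /dvdXn_eqP h := dQ_sq_mod v x0.
have d i := is_poly_derive_mul dQx dQx i.
have [n3|n3] := ltnP n 3; last first.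
  under eq_fun do rewrite coef_poly ltnNge n3 /=.
  by rewrite derive_val nth_default ?mulr0.
under eq_fun do rewrite coef_poly n3 expr2.
rewrite (@derive_val _ _ _ _ _ _ _ (is_derive_scale a (d _))).
congr (_ * _); rewrite (_ : _ + _ = 2 *: (curveQ k x * dQ k x v)); last first.
  by rewrite scaler_nat; ring.
rewrite h; last by lia.
by rewrite coef_quad; case: n n3 => [|[|[|]]].
Qed.

Lemma dtautE (a : C) x v : x 0 0 != 0 ->
  dtaut k a x v = a *: quad (dsq_coef x v 2) (dsq_coef x v 1) (dsq_coef x v 0).
Proof.
move=> x0; apply/polyP => n; rewrite coefZ coef_quad -linetaut_coef_derive //.
rewrite coef_poly; case: ltnP => // nk.
by rewrite linetaut_coef_derive // nth_default ?mulr0 //=; lia.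
Qed.

Lemma dQtE x v : x 0 0 != 0 -> dQt k x v = flip k (dQ k x v).
Proof.
move=> x0; apply/polyP => n; rewrite coef_flip coef_poly ltnS.
case: leqP => // nk; rewrite coef_poly ltnS leq_subr.
by under eq_fun do rewrite coef_poly ltnS nk.
Qed.

Lemma dtau_coef0 (a : C) x v : x 0 0 != 0 ->
  (dtau k a x v)`_0 = - a * (2 *: (curveQ k x * dQ k x v))`_k.
Proof.
move=> x0; rewrite coef_poly; under eq_fun do rewrite coef_poly addn0 expr2.
have dQx := is_poly_derive_curveQ v x0.
have d := is_poly_derive_mul dQx dQx k.
rewrite (@derive_val _ _ _ _ _ _ _ (is_derive_scale (- a) d)).
rewrite (_ : _ + _ = 2 *: (curveQ k x * dQ k x v)) //.
by rewrite scaler_nat; ring.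
Qed.

Lemma curveQ_invE x : x 0 0 != 0 ->
  exists E, curveQ k x * inv_poly x = 1 + E * 'X^k.
Proof.
move=> /curveQ_inv/dvdpP[E e]; exists E; rewrite -e; ring.
Qed.

(** At lambda = 0 the second component of the section is dtau, whose value is
    read off from the coefficient of lambda^k in Q dQ. *)
Lemma dtau_at0 (a : C) x v : x 0 0 != 0 ->
  dsq_coef x v 0 = 0 -> last_coef x v = 0 -> (dtau k a x v)`_0 = 0.
Proof.
move=> x0 q0 f0; rewrite dtau_coef0 // dQ_eq // f0 scale0r addr0.
have [E e] := curveQ_invE x0.
rewrite mulrBr scalerBr -scalerAr scalerA divff ?pnatr_eq0 // scale1r.
rewrite mulrCA e [dsq_quad _ _ * _]mulrDr mulr1 [dsq_quad _ _ * _]mulrA.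
rewrite coefB coefD coefMXn ltnn subnn -scalerAr !coefZ coefMXn ltnSn !mulr0 subr0.
rewrite coef0M /dsq_quad !coef_quad /= q0 mul0r addr0 nth_default ?mulr0 //=.
Qed.

Definition potential x : C := inv_coef x (k - 1) / 2.

Definition theta x v : C :=
  v 0 3 - 4^-1 * inv_coef x (k - 1) * dsq_coef x v 1
  - 2^-1 * inv_coef x (k - 2) * dsq_coef x v 2.

(** Null coframe of the Gibbons-Hawking metric: the quadratic form is
    l_0 l_3 - l_1 l_2 = V (dq_0 dq_2 - dq_1^2 / 4) + theta^2 / V. *)
Definition coframe x v (j : nat) : C :=
  [:: potential x * dsq_coef x v 0;
      2^-1 * dsq_coef x v 1 - theta x v / potential x;
      2^-1 * potential x * dsq_coef x v 1 + theta x v;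
      dsq_coef x v 2]`_j.

Lemma last_coefE x v :
  last_coef x v = theta x v - 2^-1 * potential x * dsq_coef x v 1.
Proof. by rewrite /last_coef /theta /potential; field. Qed.

Lemma dQ_horner x v l : x 0 0 != 0 ->
  (dQ k x v).[l] = 2^-1 * ((dsq_quad x v).[l] * (inv_poly x).[l])
    + last_coef x v * l ^+ k - potential x * dsq_coef x v 2 * l ^+ k.+1.
Proof.
move=> x0; rewrite dQ_eq // hornerD hornerN hornerD !hornerZ hornerM !hornerXn.
by rewrite /potential; congr (_ - _ * _); field.
Qed.

Lemma null_vector_nz (a : C) x v l : x 0 0 != 0 -> l != 0 ->
  (dsq_quad x v).[l] = 0 -> last_coef x v = potential x * dsq_coef x v 2 * l ->
  null_vector k a x v.
Proof.
move=> x0 l0 ql fl; left; exists l^-1; split.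
  rewrite dQtE // flipE ?invr_eq0 // ?size_poly // invrK dQ_horner // ql mul0r mulr0 add0r.
  by rewrite fl -mulrA -exprS subrr mulr0.
rewrite dtautE // hornerZ; move: ql; rewrite !horner_quad => ql.
apply/eqP; rewrite mulf_eq0; apply/orP; right; apply/eqP.
by rewrite -[RHS](mulr0 (l ^- 2)) -ql; field.
Qed.

Lemma null_vector_0 (a : C) x v : x 0 0 != 0 ->
  dsq_coef x v 0 = 0 -> last_coef x v = 0 -> null_vector k a x v.
Proof.
move=> x0 q0 f0; right; exists 0; rewrite !horner_coef0; split; last exact: dtau_at0.
rewrite -horner_coef0 dQ_horner // f0 mul0r addr0 !horner_coef0 coef_quad /= q0.
by rewrite exprS !mul0r !mulr0 subr0.
Qed.

Lemma null_vector_oo (a : C) x v : x 0 0 != 0 ->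
  dsq_coef x v 2 = 0 -> v 0 3 = 0 -> null_vector k a x v.
Proof.
move=> x0 q2 v3; left; exists 0; rewrite !horner_coef0; split.
  by rewrite dQtE // coef_flip subn0 dQ_k.
by rewrite dtautE // coefZ coef_quad /= q2 mulr0.
Qed.

(** A zero l <> 0 of dq is a zero of dQ when last_coef = V dq_2 l.  If dq_2 is
    non-zero this determines l, and dq(l) = 0 becomes the quadratic equation; in
    the degenerate cases the common zero may be 0 or infinity. *)
Lemma null_vector_coframe (a : C) x v : x 0 0 != 0 -> potential x != 0 ->
  coframe x v 0 * coframe x v 3 = coframe x v 1 * coframe x v 2 ->
  null_vector k a x v.
Proof.
move=> x0 V0; rewrite /coframe /=.
have fE := last_coefE x v.
set V := potential x in V0 fE *; set th := theta x v in fE *.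
set q0 := dsq_coef x v 0; set q1 := dsq_coef x v 1 in fE *; set q2 := dsq_coef x v 2.
set f := last_coef x v in fE.
have -> : th = f + 2^-1 * V * q1 by rewrite fE; ring.
move=> nul.
have {}nul : V ^+ 2 * (q0 * q2) + V * q1 * f + f ^+ 2 = 0.
  apply: (mulfI (invr_neq0 V0)); rewrite mulr0.
  move/eqP: nul; rewrite -subr_eq0 => /eqP <-; field; exact: V0.
have [q20|q20] := eqVneq q2 0.
  have v3E : f = v 0 3 - V * q1.
    by rewrite /f /last_coef -/q1 -/q2 q20 mul0r addr0 /V /potential; field.
  move: nul; rewrite q20 !mulr0 add0r.
  rewrite (_ : _ + _ = f * (f + V * q1)); last by ring.
  move/eqP; rewrite mulf_eq0 => /orP[/eqP f0|/eqP fV]; last first.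
    by apply: null_vector_oo => //; move: fV; rewrite v3E subrK.
  have [q10|q10] := eqVneq q1 0.
    by apply: null_vector_oo => //; move: v3E; rewrite f0 q10 mulr0 subr0.
  have [q00|q00] := eqVneq q0 0; first exact: null_vector_0.
  apply: (@null_vector_nz _ _ _ (- q0 / q1)) => //.
  - by rewrite mulf_neq0 ?oppr_eq0 ?invr_eq0.
  - by rewrite horner_quad -/q0 -/q1 -/q2 q20; field.
  - by rewrite -/f f0 -/q2 q20 mulr0 mul0r.
have [f0|f0] := eqVneq f 0.
  move: nul; rewrite f0 mulr0 addr0 expr0n /= addr0 => nul.
  apply: null_vector_0 => //.
  by apply: (mulIf q20); apply: (mulfI (expf_neq0 2 V0)); rewrite nul mul0r mulr0.
apply: (@null_vector_nz _ _ _ (f / (V * q2))) => //.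
- by rewrite mulf_neq0 // invr_eq0 mulf_neq0.
- rewrite horner_quad -/q0 -/q1 -/q2.
  transitivity ((V ^+ 2 * (q0 * q2) + V * q1 * f + f ^+ 2) / (V ^+ 2 * q2)).
    by field; rewrite V0 q20.
  by rewrite nul mul0r.
- by rewrite -/f -/V -/q2; field; rewrite V0 q20.
Qed.

End TwistorCurve.

(** * Null coframe and self-dual two-forms *)

Section Matrix4.
Variable C : numClosedFieldType.

Lemma sum4 (F : 'I_4 -> C) : \sum_(i < 4) F i = F 0 + F 1 + F 2 + F 3.
Proof.
rewrite !big_ord_recl big_ord0 addr0 !addrA.
by congr (F _ + F _ + F _ + F _); apply/val_inj.
Qed.

Lemma sum3 (F : 'I_3 -> C) : \sum_(i < 3) F i = F 0 + F 1 + F 2.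
Proof.
rewrite !big_ord_recl big_ord0 addr0 !addrA.
by congr (F _ + F _ + F _); apply/val_inj.
Qed.

Lemma forall_ord4 (P : 'I_4 -> Prop) : P 0 -> P 1 -> P 2 -> P 3 -> forall i, P i.
Proof.
move=> p0 p1 p2 p3 [[|[|[|[|m]]]] lt] //.
- by rewrite (_ : Ordinal lt = 0) //; apply/val_inj.
- by rewrite (_ : Ordinal lt = 1) //; apply/val_inj.
- by rewrite (_ : Ordinal lt = 2) //; apply/val_inj.
- by rewrite (_ : Ordinal lt = 3) //; apply/val_inj.
Qed.

Lemma forall_ord3 (P : 'I_3 -> Prop) : P 0 -> P 1 -> P 2 -> forall i, P i.
Proof.
move=> p0 p1 p2 [[|[|[|m]]] lt] //.
- by rewrite (_ : Ordinal lt = 0) //; apply/val_inj.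
- by rewrite (_ : Ordinal lt = 1) //; apply/val_inj.
- by rewrite (_ : Ordinal lt = 2) //; apply/val_inj.
Qed.

Lemma unitmx_inj n (M : 'M[C]_n) : (forall v : 'rV_n, v *m M = 0 -> v = 0) -> M \in unitmx.
Proof. by move=> h; rewrite -row_free_unit; apply: inj_row_free. Qed.

(** Gram matrix of l_0 l_3 - l_1 l_2. *)
Definition null_gram : 'M[C]_4 :=
  \matrix_(i, j) (if i + j == 3 :> nat then (if (i == 0) || (j == 0) then 2^-1 else - 2^-1) else 0).

Lemma row_mul4 (u : 'rV[C]_4) (M : 'M[C]_4) j :
  (u *m M) 0 j = u 0 0 * M 0 j + u 0 1 * M 1 j + u 0 2 * M 2 j + u 0 3 * M 3 j.
Proof. by rewrite mxE sum4. Qed.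

Lemma null_gramE (u w : 'rV[C]_4) :
  (u *m null_gram *m w^T) 0 0 =
  2^-1 * (u 0 0 * w 0 3 + u 0 3 * w 0 0 - u 0 1 * w 0 2 - u 0 2 * w 0 1).
Proof. rewrite mxE sum4 !row_mul4 !mxE /=; ring. Qed.

(** Skew form l_0 /\ l_3 - l_1 /\ l_2. *)
Definition skew_gram : 'M[C]_4 :=
  \matrix_(i, j) (if i + j == 3 :> nat then [:: 1; -1; 1; -1]`_i else 0).

Lemma skew_gramE (u w : 'rV[C]_4) :
  (u *m skew_gram *m w^T) 0 0 =
  u 0 0 * w 0 3 - u 0 3 * w 0 0 - u 0 1 * w 0 2 + u 0 2 * w 0 1.
Proof. by rewrite mxE sum4 !row_mul4 !mxE /=; ring. Qed.

Lemma congr_entry n (P M : 'M[C]_n) i j :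
  (P *m M *m P^T) i j
  = (((delta_mx 0 i : 'rV_n) *m P) *m M *m ((delta_mx 0 j : 'rV_n) *m P)^T) 0 0.
Proof.
by rewrite trmx_mul trmx_delta !mulmxA -colE [RHS]mxE -!mulmxA -rowE [RHS]mxE.
Qed.

Lemma null_gram_unit : null_gram \in unitmx.
Proof.
apply: (proj1 (mulmx1_unit (B := 4 *: null_gram) _)).
apply/matrixP; elim/forall_ord4; elim/forall_ord4; rewrite !mxE sum4 !mxE /=; by field.
Qed.

Lemma skew_gram_unit : skew_gram \in unitmx.
Proof.
apply: (proj1 (mulmx1_unit (B := - skew_gram) _)).
by apply/matrixP; elim/forall_ord4; elim/forall_ord4; rewrite !mxE sum4 !mxE /=; ring.
Qed.

End Matrix4.

Section Coframe.
Variables (C : numClosedFieldType) (k : nat).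
Hypothesis k3 : (3 <= k)%N.
Implicit Types (x v y : 'rV[C]_4).

Definition coframe_mx x : 'M[C]_4 := \matrix_(i, j) coframe k x (delta_mx 0 i) j.

Lemma coframe_mxE x v j : (v *m coframe_mx x) 0 j = coframe k x v j.
Proof.
rewrite row_mul4 !mxE; elim/forall_ord4: j => /=.
all: by rewrite /coframe /theta /dsq_coef !mxE /=; ring.
Qed.

Lemma coframe_mx_unit x : x 0 0 != 0 -> potential k x != 0 -> coframe_mx x \in unitmx.
Proof.
move=> x0 V0; apply: unitmx_inj => v vP.
have h j : coframe k x v j = 0.
  have [j4|j4] := ltnP j 4; last by rewrite /coframe nth_default.
  by rewrite -(coframe_mxE x v (Ordinal j4)) vP mxE.
have := (h 0%N, h 1%N, h 2, h 3); rewrite /coframe /=.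
have n20 : 2 != 0 :> C by rewrite pnatr_eq0.
set V := potential k x in V0 *; move=> [[[/eqP h0 h1] h2] q2].
have q0 : dsq_coef x v 0 = 0 by move: h0; rewrite mulf_eq0 (negbTE V0) => /eqP.
have q1 : dsq_coef x v 1 = 0.
  apply: (mulfI V0); rewrite mulr0 -[RHS](addr0 0) -{1}h2.
  by rewrite -[X in _ = _ + X](mulr0 V) -h1; field.
have th : theta k x v = 0 by move: h2; rewrite q1 mulr0 add0r.
have v0 : v 0 0 = 0.
  move/eqP: q0; rewrite /dsq_coef /= !mulf_eq0 (negbTE n20) (negbTE x0) /=.
  by move/eqP.
have v1 : v 0 1 = 0.
  move/eqP: q1; rewrite /dsq_coef /= v0 mulr0 addr0 !mulf_eq0 (negbTE n20) (negbTE x0) /=.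
  by move/eqP.
have v2 : v 0 2 = 0.
  move/eqP: q2; rewrite /dsq_coef /= v0 v1 !mulr0 addr0 add0r !mulf_eq0.
  by rewrite (negbTE n20) (negbTE x0) /= => /eqP.
have v3 : v 0 3 = 0.
  by move: th; rewrite /theta /dsq_coef /= v0 v1 v2 !(mulr0, addr0, subr0).
by apply/rowP; elim/forall_ord4; rewrite mxE.
Qed.

(** Sigma_0, Sigma_1, Sigma_2 divided by a: l_2 /\ l_3,
    l_0 /\ l_3 - l_1 /\ l_2 and l_0 /\ l_1. *)
Definition sigma_form (n : nat) x v w : C :=
  let l := coframe k x v in let m := coframe k x w in
  [:: l 2%N * m 3%N - l 3%N * m 2%N;
      l 0%N * m 3%N - l 3%N * m 0%N - l 1%N * m 2%N + l 2%N * m 1%N;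
      l 0%N * m 1%N - l 1%N * m 0%N]`_n.

Lemma coefM1 (p q : {poly C}) : (p * q)`_1 = p`_0 * q`_1 + p`_1 * q`_0.
Proof. by rewrite coefM !big_ord_recl big_ord0 addr0. Qed.

Lemma coefM2 (p q : {poly C}) :
  (p * q)`_2 = p`_0 * q`_2 + p`_1 * q`_1 + p`_2 * q`_0.
Proof. by rewrite coefM !big_ord_recl big_ord0 addr0 addrA. Qed.

(** The pair t holds s_(k-3) and s_(k-4), which cancel in the two-forms Sigma_n;
    for k = 3 there is no s_(k-4). *)
Lemma dQt_coefs x : x 0 0 != 0 -> exists t, forall w,
  [/\ (dQt k x w)`_0 = w 0 3,
      (dQt k x w)`_1 = 2^-1 * (dsq_coef x w 0 * inv_coef x (k - 1)
         + dsq_coef x w 1 * inv_coef x (k - 2) + dsq_coef x w 2 * t.1) &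
      (dQt k x w)`_2 = 2^-1 * (dsq_coef x w 0 * inv_coef x (k - 2)
         + dsq_coef x w 1 * t.1 + dsq_coef x w 2 * t.2)].
Proof.
move=> x0.
exists (inv_coef x (k - 3), if (k - 2)%N is m.+2 then inv_coef x m else 0) => w.
have n20 : 2 != 0 :> C by rewrite pnatr_eq0.
have dQlow n : (n < k)%N ->
    (dQ k x w)`_n = 2^-1 * (dsq_quad x w * inv_poly k x)`_n.
  move=> nk; have /dvdXn_eqP/(_ n nk) := dQ_mod k3 w x0.
  by rewrite coefZ => <-; rewrite mulKf.
rewrite !dQtE // !coef_flip subn0 dQ_k.
rewrite (_ : (1 <= k)%N); last by lia.
rewrite (_ : (2 <= k)%N); last by lia.
split=> //; rewrite dQlow; try lia; congr (_ * _).
  rewrite coef_quadM_ge2; last by lia.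
  rewrite !coef_inv_poly !ifT; try lia.
  have -> : (k - 1 - 1 = k - 2)%N by lia.
  by have -> : (k - 1 - 2 = k - 3)%N by lia.
rewrite coef_quadM; case kE : (k - 2)%N => [|m]; first by lia.
rewrite !coef_inv_poly !ifT; try lia.
rewrite (_ : (k - 3)%N = m) /=; last by lia.
by case: m kE => [|m] kE //; rewrite coef_inv_poly ifT //; lia.
Qed.

(** Modulo multiples of dq, which do not contribute to a wedge product with
    a dq, the first component of a section is l^k (last_coef - V dq_2 l). *)
Lemma wedge_coef (a : C) x n v w : (n < 3)%N -> x 0 0 != 0 -> potential k x != 0 ->
  (dQt k x v * dtaut k a x w - dQt k x w * dtaut k a x v)`_n
  = a * sigma_form n x v w.
Proof.
move=> n3 x0 V0; have [t tE] := dQt_coefs x0.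
have [v0 v1 v2] := tE v; have [w0 w1 w2] := tE w.
have taut u : [/\ (dtaut k a x u)`_0 = a * dsq_coef x u 2,
    (dtaut k a x u)`_1 = a * dsq_coef x u 1 & (dtaut k a x u)`_2 = a * dsq_coef x u 0].
  by rewrite dtautE // !coefZ !coef_quad.
have sE : inv_coef x (k - 1) = 2 * potential k x.
  by rewrite /potential mulrC divfK // pnatr_eq0.
have [tv0 tv1 tv2] := taut v; have [tw0 tw1 tw2] := taut w.
rewrite coefB /sigma_form /coframe /theta sE.
rewrite sE in v1 v2 w1 w2; clear tE taut sE.
move: (dQt k x v) (dQt k x w) (dtaut k a x v) (dtaut k a x w)
  v0 v1 v2 w0 w1 w2 tv0 tv1 tv2 tw0 tw1 tw2 => p q r s.
move: (potential k x) V0 (inv_coef x (k - 2)) (t.1) (t.2) (v 0 3) (w 0 3).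
move: (dsq_coef x v 0) (dsq_coef x v 1) (dsq_coef x v 2).
move: (dsq_coef x w 0) (dsq_coef x w 1) (dsq_coef x w 2).
clear -n3 => w2 w1 w0 v2 v1 v0 V V0 s' t1 t2 v3 w3 p0 p1 p2 q0 q1 q2 r0 r1 r2 s0 s1 s2.
case: n n3 => [|[|[|//]]] _ /=.
- by rewrite !coef0M p0 q0 r0 s0; field.
- by rewrite !coefM1 p0 q0 r0 s0 p1 q1 r1 s1; field.
- by rewrite !coefM2 p0 q0 r0 s0 p1 q1 r1 s1 p2 q2 r2 s2; field.
Qed.

Lemma Sigma_entry (a : C) x n i j : (n < 3)%N -> x 0 0 != 0 -> potential k x != 0 ->
  Sigma k a n x i j = a * sigma_form n x (delta_mx 0 i) (delta_mx 0 j).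
Proof. by move=> n3 x0 V0; rewrite mxE wedge_coef. Qed.

End Coframe.

(** * Splitting type of the normal bundle *)

Section NormalBundle.
Variables (C : numClosedFieldType) (k : nat) (a : C) (x : 'rV[C]_4).
Hypotheses (k3 : (3 <= k)%N) (a0 : a != 0) (x0 : x 0 0 != 0).

Local Notation S := (inv_poly k x).
Local Notation Q := (curveQ k x).
Local Notation s := (inv_coef x (k - 1)).

Lemma sum2 (A : nmodType) (F : 'I_2 -> A) : \sum_(i < 2) F i = F 0 + F 1.
Proof. by rewrite !big_ord_recl big_ord0 addr0; congr (F _ + F _); apply/val_inj. Qed.

Lemma forall_ord2 (P : 'I_2 -> Prop) : P 0 -> P 1 -> forall i, P i.
Proof.
move=> p0 p1 [[|[|m]] lt] //.
- by rewrite (_ : Ordinal lt = 0) //; apply/val_inj.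
- by rewrite (_ : Ordinal lt = 1) //; apply/val_inj.
Qed.

Lemma unitmx2 (M : 'M[{poly C}]_2) (d : C) : d != 0 ->
  M 0 0 * M 1 1 - M 0 1 * M 1 0 = d%:P -> M \in unitmx.
Proof.
move=> d0 e; rewrite unitmxE (expand_det_row _ 0) sum2 /cofactor !det_mx11 !mxE.
rewrite [X in X \is a _](_ : _ = d%:P); last first.
  rewrite -e /= addn0 add0n expr0 expr1 mulN1r mul1r mulrN.
  by congr (_ * M _ _ - _ * M _ _); apply/val_inj.
by rewrite poly_unitE size_polyC d0 coefC /= unitfE.
Qed.

(** Write Q S = 1 + E l^k and T = l S - s_(k-1) l^k.  Both l^(1-k) S and
    l^(1-k) T are polynomials in 1/l, and S Q = 1, T Q = l up to multiples of
    l^k; combining the two rows of the gluing matrix with these coefficients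
    produces a polynomial matrix divided by l.  All determinants are constant
    multiples of s_(k-1). *)
Lemma normal_bundle_splits_potential :
  potential k x != 0 -> normal_bundle_splits k a Q 1 1.
Proof.
move=> V0; have s0 : s != 0.
  by apply: contraNneq V0; rewrite /potential => ->; rewrite mul0r.
have [E QS] := curveQ_invE k3 x0.
have n2a : 2 * a != 0 by rewrite mulf_neq0 ?pnatr_eq0.
pose T := 'X * S - s *: 'X^k.
have sT : (size T <= k)%N.
  apply/leq_sizeP => j kj; rewrite coefB coefZ coefXn coefXM.
  case: j kj => [|j] kj; first by lia.
  rewrite /= coef_inv_poly; have [->|jk] := eqVneq j (k - 1)%N.
    have -> : ((k - 1).+1 == k) by lia.
    by rewrite ifT ?mulr1 ?subrr //; lia.
  have -> : (j.+1 == k) = false by lia.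
  by rewrite ifF ?mulr0 ?subrr //; lia.
have kE : k.-1.+1 = k by lia.
pose H : 'M[{poly C}]_2 := \matrix_(i, j)
  if i == 0 then (if j == 0 then E else (2 * a)^-1 *: S)
  else (if j == 0 then 'X * E - s *: Q else (2 * a)^-1 *: T).
pose Ht : 'M[{poly C}]_2 := \matrix_(i, j)
  if i == 0 then (if j == 0 then - 'X else (2 * a)^-1 *: flip k.-1 S)
  else (if j == 0 then - 1 else (2 * a)^-1 *: flip k.-1 T).
have d0 : (2 * a)^-1 * s != 0 by rewrite mulf_neq0 ?invr_eq0.
exists H, Ht; split.
- apply: (unitmx2 d0); rewrite !mxE /= /T polyCM -!mul_polyC.
  rewrite (_ : _ - _ = ((2 * a)^-1)%:P * s%:P * (Q * S - E * 'X^k)); last by ring.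
  by rewrite QS addrK mulr1.
- apply: (unitmx2 d0); rewrite !mxE /= polyCM -!mul_polyC.
  rewrite (_ : _ - _ = ((2 * a)^-1)%:P * (flip k.-1 S - 'X * flip k.-1 T)); last by ring.
  congr (_ * _); apply/polyP => i; rewrite coefB coefXM !coef_flip coefC.
  have Tj j : (j < k.-1)%N -> T`_j.+1 = S`_j.
    move=> jk; rewrite coefB coefZ coefXn coefXM /= (_ : (_ == k) = false) ?mulr0 ?subr0 //.
    by lia.
  have T0 : T`_0 = 0.
    by rewrite coefB coefZ coefXn coefXM /= (_ : (_ == k) = false) ?mulr0 ?subr0 //; lia.
  case: i => [|i] /=.
    by rewrite subr0 subn0 coef_inv_poly ifT ?subn1 //; lia.
  have [ik|ik|ik] := ltngtP i k.-1.
  + rewrite (_ : (k.-1 - i = (k.-1 - i.+1).+1)%N) ?Tj ?subrr //; lia.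
  + by rewrite subrr.
  + by rewrite ik subnn T0 subrr.
move=> l l0; have fl (p : {poly C}) : (size p <= k)%N -> (flip k.-1 p).[l^-1] = l ^- k * l * p.[l].
  move=> sp; rewrite flipE ?kE ?invr_eq0 // invrK exprVn -[in l ^- k]kE exprS.
  by rewrite [l * _]mulrC invfM divfK.
have QSl : S.[l] * Q.[l] = 1 + E.[l] * l ^+ k.
  by rewrite mulrC -hornerM QS !hornerE.
have lk : l ^+ k = l ^+ 2 * l ^+ (k - 2) by rewrite -exprD; congr (_ ^+ _); lia.
have lk0 : l ^+ k != 0 by rewrite expf_neq0.
have lk2 : l ^+ (k - 2) != 0 by rewrite expf_neq0.
have El : E.[l] = (S.[l] * Q.[l] - 1) / l ^+ k by rewrite QSl addrC addKr mulfK.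
have Tl : T.[l] = l * S.[l] - s * l ^+ k.
  by rewrite hornerD hornerN hornerM hornerX hornerZ hornerXn.
have sS : (size S <= k)%N by exact: size_poly.
apply/matrixP; apply: forall_ord2; apply: forall_ord2; rewrite mul_diag_mx !mxE sum2 !mxE /= ?exprN1 /horner_eval.
- rewrite hornerN hornerX hornerZ fl // El.
  by move: (l ^+ k) lk0 S.[l] Q.[l] => y y0 p q; field; rewrite ?l0 ?y0 ?a0.
- rewrite mulr0 add0r !hornerZ fl // lk.
  by move: (l ^+ (k - 2)) lk2 S.[l] => y y0 p; field; rewrite ?l0 ?y0 ?a0.
- rewrite hornerN hornerC hornerZ fl // Tl hornerD hornerN hornerM hornerX hornerZ El.
  by move: (l ^+ k) lk0 S.[l] Q.[l] s => y y0 p q t; field; rewrite ?l0 ?y0 ?a0.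
- rewrite mulr0 add0r !hornerZ fl // lk.
  by move: (l ^+ (k - 2)) lk2 T.[l] => y y0 p; field; rewrite ?l0 ?y0 ?a0.
Qed.

(** A function regular at 0 and at infinity is constant. *)
Lemma poly_at_infinity (f h : {poly C}) :
  (forall l, l != 0 -> f.[l] = h.[l^-1]) -> f`_0 = 0 -> f = 0.
Proof.
move=> fh f0; pose N := size h.
have e : 'X^N * f = flip N h.
  apply: poly_eq_nz => l l0; rewrite hornerM hornerXn flipE ?fh //.
apply/polyP => i; rewrite coef0; case: i => // i.
have := congr1 (fun p : {poly C} => p`_(N + i.+1)) e.
by rewrite /= coefXnM ltnNge leq_addr /= addKn coef_flip ifF //; lia.
Qed.

(** If s_(k-1) = 0 then (l^2 S, - 2 a l^2 E) is a section of the normal bundle,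
    where Q S = 1 + E l^k: in the other chart it is given by polynomials in 1/l.
    It has a double zero at l = 0, which no non-zero section of O(1) + O(1) has. *)
Lemma potential_neq0_splits :
  normal_bundle_splits k a Q 1 1 -> potential k x != 0.
Proof.
move=> [H [Ht [uH uHt glue]]]; apply/eqP => V0.
have s0 : s = 0.
  by move/eqP: V0; rewrite mulf_eq0 invr_eq0 pnatr_eq0 orbF => /eqP.
have [E QS] := curveQ_invE k3 x0.
pose u : 'cV[{poly C}]_2 := \col_i if i == 0 then S else - (2 * a) *: E.
pose ut : 'cV[{poly C}]_2 := \col_i if i == 0 then flip k ('X^2 * S) else (2 * a)%:P.
have sS : leq (size ('X^2 * S)) k.+1.
  apply/leq_sizeP => j kj; rewrite coefXnM coef_inv_poly ifF; last by lia.
  have [->|jk] := eqVneq j k.+1; last by rewrite ifF //; lia.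
  by rewrite (_ : k.+1 - 2 = k - 1)%N ?s0 ?if_same //; lia.
have Xu : 'X *: (H *m u) = 0.
  apply/matrixP => i j; rewrite [RHS]mxE.
  apply: (@poly_at_infinity _ ((Ht *m ut) i j)); last by rewrite mxE coefXM.
  move=> l l0; have gl i' j' := congr1 (fun M : 'M[C]_2 => M i' j') (glue l l0).
  have := gl i 0; have := gl i 1; rewrite /= mul_diag_mx !mxE !sum2 !mxE /=.
  rewrite exprN1 if_same mulr0 add0r /horner_eval => e1 e0.
  have H0 : (H i 0).[l] = l * ((Ht i 0).[l^-1] / l ^+ k
      + (Ht i 1).[l^-1] * (2 * a / l ^+ 2 * Q.[l])) by rewrite e0 mulVKf.
  have H1 : (H i 1).[l] = l * ((Ht i 1).[l^-1] * l ^+ (k - 2)) by rewrite e1 mulVKf.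
  have QSl : Q.[l] * S.[l] = 1 + E.[l] * l ^+ k by rewrite -hornerM QS !hornerE.
  have lk : l ^+ k = l ^+ 2 * l ^+ (k - 2) by rewrite -exprD; congr (_ ^+ _); lia.
  have lk0 : l ^+ k != 0 by rewrite expf_neq0.
  have lk2 : l ^+ (k - 2) != 0 by rewrite expf_neq0.
  have El : E.[l] = (Q.[l] * S.[l] - 1) / l ^+ k by rewrite QSl addrC addKr mulfK.
  rewrite hornerM hornerX !hornerD !hornerM hornerZ hornerC H0 H1.
  rewrite flipE ?invr_eq0 // invrK hornerM hornerXn El exprVn lk.
  by move: (l ^+ (k - 2)) lk2 S.[l] Q.[l] => y y0 p q; field; rewrite ?l0 ?y0.
have u0 : u = 0.
  have Hu : H *m u = 0.
    apply/matrixP => i j; rewrite [RHS]mxE; apply: (mulfI (negbT (polyX_eq0 C))).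
    by have := congr1 (fun M : 'cV[{poly C}]_2 => M i j) Xu; rewrite /= !mxE mulr0.
  by rewrite -[u](mulKmx uH) Hu mulmx0.
have : S`_0 = 0.
  by have /matrixP/(_ 0 0) := u0; rewrite !mxE /= => ->; rewrite coef0.
rewrite coef_inv_poly ifT; last by lia.
by move/eqP; rewrite invr_eq0 (negbTE x0).
Qed.

End NormalBundle.

Section RegularDomain.
Variables (C : numClosedFieldType) (k : nat) (a : C).
Hypotheses (k3 : (3 <= k)%N) (a0 : a != 0).
Implicit Types (x v y : 'rV[C]_4).

Lemma regular_domainP x :
  regular_domain k a x <-> x 0 0 != 0 /\ potential k x != 0.
Proof.
split=> [[x0 spl]|[x0 V0]]; split=> //.
  exact: potential_neq0_splits spl.
exact: normal_bundle_splits_potential.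
Qed.

Lemma differentiable_sq_coef x n : differentiable (fun y => sq_coef y n) x.
Proof.
have d i : differentiable (fun y : 'rV[C]_4 => y 0 i) x by exact: differentiable_coord.
have d0 : differentiable (fun y : 'rV[C]_4 => 2 * y 0 0) x.
  by apply: differentiable_mul => //; exact: differentiable_const.
rewrite /sq_coef; case: n => [|[|[|n]]] /=.
- exact: differentiable_exp.
- exact: differentiable_mul.
- apply: differentiable_add; first exact: differentiable_exp.
  exact: differentiable_mul.
- by under eq_fun do rewrite nth_nil; exact: differentiable_const.
Qed.

Lemma differentiable_inv_coef x n : x 0 0 != 0 ->
  differentiable (fun y => inv_coef y n) x.
Proof.
move=> x0; apply: differentiable_isqrt_coef; try exact: differentiable_sq_coef.
by apply: differentiableV => //; exact: differentiable_coord.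
Qed.

Lemma differentiable_potential x : x 0 0 != 0 -> differentiable (potential k) x.
Proof.
move=> x0; apply: differentiable_mul; first exact: differentiable_inv_coef.
exact: differentiable_const.
Qed.

Lemma near_regular x : regular_domain k a x -> \forall y \near x, regular_domain k a y.
Proof.
move=> /regular_domainP[x0 V0].
have c := differentiable_continuous (differentiable_potential x0).
have V0' : \forall y \near x, potential k y != 0 by exact: cvgr_neq0 c V0.
have x0' := near_x0 x0.
by near=> y; apply/regular_domainP; split; near: y.
Unshelve. all: by end_near. Qed.

End RegularDomain.

(** * The conformal factor and the Killing vector *)

Section NullCone.
Variable C : numClosedFieldType.

(** The quadric u_0 u_3 = u_1 u_2 contains the four basis vectors, the sums of
    two basis vectors spanning a line of it, and (1, 1, 1, 1); these nine points
    determine the ten coefficients up to a factor. *)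
Lemma quadric_eq0 (B : 'M[C]_4) : B^T = B ->
  (forall u : 'rV_4, u 0 0 * u 0 3 = u 0 1 * u 0 2 -> u *m B *m u^T = 0) ->
  B = (2 * B 0 3) *: null_gram C.
Proof.
move=> Bs Bn.
have sym i j : B i j = B j i by rewrite -{1}Bs mxE.
have q p1 p2 p3 p4 : p1 * p4 = p2 * p3 ->
    p1 ^+ 2 * B 0 0 + p2 ^+ 2 * B 1 1 + p3 ^+ 2 * B 2 2 + p4 ^+ 2 * B 3 3
    + 2 * (p1 * p2 * B 0 1 + p1 * p3 * B 0 2 + p1 * p4 * B 0 3
           + p2 * p3 * B 1 2 + p2 * p4 * B 1 3 + p3 * p4 * B 2 3) = 0.
  move=> e; pose u : 'rV[C]_4 := \row_(i < 4) [:: p1; p2; p3; p4]`_i.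
  have ue : u 0 0 * u 0 3 = u 0 1 * u 0 2 by rewrite !mxE.
  have := congr1 (fun M : 'M[C]_1 => M 0 0) (Bn u ue).
  rewrite /= mxE sum4 !row_mul4 !mxE /= => <-.
  rewrite (sym 1 0) (sym 2 0) (sym 3 0) (sym 2 1) (sym 3 1) (sym 3 2); ring.
have b00 : B 0 0 = 0 by rewrite -(q 1 0 0 0); ring.
have b11 : B 1 1 = 0 by rewrite -(q 0 1 0 0); ring.
have b22 : B 2 2 = 0 by rewrite -(q 0 0 1 0); ring.
have b33 : B 3 3 = 0 by rewrite -(q 0 0 0 1); ring.
have half (z : C) : 2 * z = 0 -> z = 0.
  by move/eqP; rewrite mulf_eq0 pnatr_eq0 => /eqP.
have b01 : B 0 1 = 0.
  by apply: half; rewrite -(q 1 1 0 0); rewrite ?b00 ?b11; ring.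
have b02 : B 0 2 = 0.
  by apply: half; rewrite -(q 1 0 1 0); rewrite ?b00 ?b22; ring.
have b13 : B 1 3 = 0.
  by apply: half; rewrite -(q 0 1 0 1); rewrite ?b11 ?b33; ring.
have b23 : B 2 3 = 0.
  by apply: half; rewrite -(q 0 0 1 1); rewrite ?b22 ?b33; ring.
have b12 : B 1 2 = - B 0 3.
  apply/eqP; rewrite -addr_eq0; apply/eqP/half.
  by rewrite -(q 1 1 1 1); rewrite ?b00 ?b11 ?b22 ?b33 ?b01 ?b02 ?b13 ?b23; ring.
have := (sym 1 0, sym 2 0, sym 3 0, sym 2 1, sym 3 1, sym 3 2).
rewrite b01 b02 b12 b13 b23 => -[[[[[c10 c20] c30] c21] c31] c32].
apply/matrixP; apply: forall_ord4; apply: forall_ord4; rewrite !mxE /=.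
all: rewrite ?b00 ?b11 ?b22 ?b33 ?b01 ?b02 ?b12 ?b13 ?b23 ?c10 ?c20 ?c30 ?c21 ?c31 ?c32.
all: by field.
Qed.

(** Linear algebra behind the rigidity of the conformal factor: comparing a
    coframe P with the connection matrix G gives DP = G P + P N; invariance of
    the constant form K forces N to be trace-free, and then invariance of
    f J forces Df = 0. *)
Lemma conformal_factor_rigid n (P DP G J K : 'M[C]_n.+1) (f df : C) :
  P \in unitmx -> J \in unitmx -> K \in unitmx ->
  DP *m K *m P^T + P *m K *m DP^T = G *m (P *m K *m P^T) + P *m K *m P^T *m G^T ->
  df *: (P *m J *m P^T) + f *: (DP *m J *m P^T + P *m J *m DP^T)
    = f *: (G *m (P *m J *m P^T) + P *m J *m P^T *m G^T) ->
  df = 0.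
Proof.
move=> uP uJ uK eK eJ.
pose N := invmx P *m (DP - G *m P).
have DPE : DP = G *m P + P *m N by rewrite mulmxA mulmxV // mul1mx addrC subrK.
have uPt : P^T \in unitmx by rewrite unitmx_tr.
have cancelP (M : 'M[C]_n.+1) : P *m M *m P^T = 0 -> M = 0.
  by move=> e; rewrite -[M](mulKmx uP) -[P *m M](mulmxK uPt) e mul0mx mulmx0.
have inv (M : 'M[C]_n.+1) : DP *m M *m P^T + P *m M *m DP^T
    = G *m (P *m M *m P^T) + P *m M *m P^T *m G^T + P *m (N *m M + M *m N^T) *m P^T.
  rewrite DPE linearD /= !trmx_mul !mulmxDl !mulmxDr !mulmxDl !mulmxA.
  by rewrite addrACA [X in _ + X]addrC; congr (_ + _); rewrite addrC.
have NK : N *m K + K *m N^T = 0.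
  by apply: cancelP; move: eK; rewrite inv => /(canRL (addKr _)); rewrite addNr.
have trN : \tr N = 0.
  have /(canRL (mulmxK uK)) e : N *m K = - (K *m N^T) by apply/eqP; rewrite -addr_eq0 NK.
  have : \tr N = - \tr N.
    by rewrite {1}e mulNmx raddfN /= mxtrace_mulC mulmxA mulVmx // mul1mx mxtrace_tr.
  by move/eqP; rewrite -addr_eq0 -mulr2n mulrn_eq0 => /eqP.
have NJ : df *: J + f *: (N *m J + J *m N^T) = 0.
  apply: cancelP; rewrite mulmxDr mulmxDl -!scalemxAr -!scalemxAl.
  by move: eJ; rewrite inv scalerDr addrCA => /(canRL (addKr _)); rewrite addNr.
have := congr1 (fun M => \tr (M *m invmx J)) NJ.
rewrite /= mul0mx raddf0 mulmxDl -!scalemxAl mulmxV // mulmxDl raddfD /= !mxtraceZ raddfD /=.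
rewrite mulmxK // [\tr (J *m _ *m _)]mxtrace_mulC mulmxA mulVmx // mul1mx mxtrace_tr trN.
rewrite addr0 mulr0 addr0 mxtrace1 => /eqP.
by rewrite mulf_eq0 pnatr_eq0 orbF => /eqP.
Qed.

End NullCone.

Section MatrixFamilies.
Variables (K : numFieldType) (V : normedModType K).

Definition is_mx_derive (x v : V) m n (M : V -> 'M[K]_(m, n)) (dM : 'M[K]_(m, n)) : Prop :=
  forall i j, is_derive x v (fun y => M y i j) (dM i j).

Lemma is_mx_derive_mul (x v : V) m n p (M : V -> 'M[K]_(m, n)) (N : V -> 'M[K]_(n, p)) dM dN :
  is_mx_derive x v M dM -> is_mx_derive x v N dN ->
  is_mx_derive x v (fun y => M y *m N y) (M x *m dN + dM *m N x).
Proof.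
move=> hM hN i j; rewrite !mxE -big_split /=; under eq_fun do rewrite mxE.
by apply: is_derive_bigsum => l; exact: is_derive_mul (hM i l) (hN l j).
Qed.

Lemma is_mx_derive_congr (x v : V) n (M : V -> 'M[K]_n) dM (J : 'M[K]_n) :
  is_mx_derive x v M dM ->
  is_mx_derive x v (fun y => M y *m J *m (M y)^T) (dM *m J *m (M x)^T + M x *m J *m dM^T).
Proof.
move=> hM; have hJ : is_mx_derive x v (fun=> J) 0.
  by move=> i j; rewrite mxE; exact: is_derive_const.
have hMt : is_mx_derive x v (fun y => (M y)^T) dM^T.
  by move=> i j; rewrite mxE; under eq_fun do rewrite mxE; exact: hM.
have h := is_mx_derive_mul (is_mx_derive_mul hM hJ) hMt.
by move: h; rewrite mulmx0 add0r addrC.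
Qed.

End MatrixFamilies.

Section Metric.
Variables (C : numClosedFieldType) (k : nat) (a : C) (g : 'rV[C]_4 -> 'M[C]_4).
Hypotheses (k3 : (3 <= k)%N) (a0 : a != 0) (gP : twistor_metric k a g).
Implicit Types (x v y : 'rV[C]_4).

Local Notation P := (coframe_mx k).
Local Notation J := (null_gram C).

(** As K is the last basis vector, this is g(K, K) V, and g(K, K) = f / V for
    g = f (l_0 l_3 - l_1 l_2). *)
Definition conformal_factor x : C := g x 3 3 * potential k x.

Lemma metric_factor x : regular_domain k a x ->
  g x = conformal_factor x *: (P x *m J *m (P x)^T).
Proof.
move=> rx; have [x0 V0] := (regular_domainP k3 a0 x).1 rx.
have uP := coframe_mx_unit x0 V0.
have uPt : (P x)^T \in unitmx by rewrite unitmx_tr.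
pose B := invmx (P x) *m g x *m (invmx (P x))^T.
have gB : g x = P x *m B *m (P x)^T.
  by rewrite /B !mulmxA mulmxV // mul1mx -mulmxA trmx_inv mulVmx // mulmx1.
have Bs : B^T = B.
  by rewrite !trmx_mul trmxK (twistor_metric_sym gP rx) mulmxA.
have BE : B = (2 * B 0 3) *: J.
  apply: quadric_eq0 => // u nu.
  have -> : u *m B *m u^T = (u *m invmx (P x)) *m g x *m (u *m invmx (P x))^T.
    by rewrite trmx_mul !mulmxA.
  apply/(twistor_metric_null gP rx); apply: (null_vector_coframe k3 a x0 V0).
  have e (j : 'I_4) : coframe k x (u *m invmx (P x)) j = u 0 j.
    by rewrite -coframe_mxE mulmxKV.
  by rewrite (e 0) (e 1) (e 2) (e 3).
set b := 2 * B 0 3 in BE.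
have gE : g x = b *: (P x *m J *m (P x)^T).
  by rewrite {1}gB BE -scalemxAr -scalemxAl.
rewrite {1}gE; congr (_ *: _).
rewrite /conformal_factor gE mxE congr_entry null_gramE !coframe_mxE.
rewrite /coframe /theta /dsq_coef !mxE /=.
by move: (potential k x) V0 (inv_coef x _) => V V0 s; field.
Qed.

(** The matrix of the Levi-Civita connection in the direction i, so that a
    parallel tensor S satisfies d_i S = G S + S G^T. *)
Definition connection x i : 'M[C]_4 := \matrix_(j, m) christoffel g x m i j.

Definition pd_mx (M : 'rV[C]_4 -> 'M[C]_4) x i : 'M[C]_4 :=
  \matrix_(j, l) pd i (fun y => M y j l) x.

Lemma pd_sym x i j l : regular_domain k a x ->
  pd i (fun y => g y j l) x = pd i (fun y => g y l j) x.
Proof.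
move=> rx; apply: near_eq_derive; near=> y.
have ry : regular_domain k a y by near: y; exact: near_regular.
by rewrite -{1}(twistor_metric_sym gP ry) mxE.
Unshelve. all: by end_near. Qed.

Lemma metric_compatible x i : regular_domain k a x ->
  pd_mx g x i = connection x i *m g x + g x *m (connection x i)^T.
Proof.
move=> rx; have gs j l : g x j l = g x l j by rewrite -{1}(twistor_metric_sym gP rx) mxE.
have low p j : \sum_m g x p m * christoffel g x m i j =
    2^-1 * (pd i (fun y => g y p j) x + pd j (fun y => g y p i) x
            - pd p (fun y => g y i j) x).
  pose w : 'cV[C]_4 := \col_q (2^-1 * (pd i (fun y => g y q j) x
    + pd j (fun y => g y q i) x - pd q (fun y => g y i j) x)).
  transitivity ((g x *m (invmx (g x) *m w)) p 0); last first.
    by rewrite mulmxA mulmxV ?(twistor_metric_unit gP rx) // mul1mx mxE.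
  rewrite mxE; apply: eq_bigr => m _; rewrite mxE /christoffel mulr_sumr.
  by congr (_ * _); apply: eq_bigr => q _; rewrite mxE mulrCA.
apply/matrixP => j l; rewrite !mxE.
under eq_bigr => m _ do rewrite mxE mulrC gs.
under [X in _ + X]eq_bigr => m _ do rewrite !mxE.
rewrite !low !(@pd_sym _ _ l j) // (@pd_sym _ _ j i) // (@pd_sym _ _ l i) //.
by field.
Qed.

Lemma differentiable_coframe x v n : x 0 0 != 0 -> potential k x != 0 ->
  differentiable (fun y => coframe k y v n) x.
Proof.
move=> x0 V0.
have d i : differentiable (fun y : 'rV[C]_4 => y 0 i) x by exact: differentiable_coord.
have dc (c : C) : differentiable (fun=> c : C) x by exact: differentiable_const.
have dsq m : differentiable (fun y => dsq_coef y v m) x.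
  rewrite /dsq_coef; case: m => [|[|[|m]]] /=.
  - by do 2?[apply: differentiable_mul => //].
  - apply: differentiable_mul => //.
    by apply: differentiable_add; apply: differentiable_mul.
  - apply: differentiable_mul => //; apply: differentiable_add; last exact: differentiable_mul.
    by apply: differentiable_add; apply: differentiable_mul.
  - by under eq_fun do rewrite nth_nil.
have dV := differentiable_potential k x0.
have ds m := differentiable_inv_coef m x0.
have dth : differentiable (fun y => theta k y v) x.
  do 2![apply: differentiable_add; last by apply: differentiable_opp;
    apply: differentiable_mul => //; apply: differentiable_mul].
  exact: dc.
rewrite /coframe; case: n => [|[|[|[|n]]]] /=.
- exact: differentiable_mul.
- apply: differentiable_add; first exact: differentiable_mul.
  apply/differentiable_opp/differentiable_mul => //; exact: differentiableV.
- apply: differentiable_add => //; apply: differentiable_mul => //.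
  exact: differentiable_mul.
- exact: dsq.
- by under eq_fun do rewrite nth_nil.
Qed.

Lemma differentiable_conformal_factor x : regular_domain k a x ->
  differentiable conformal_factor x.
Proof.
move=> rx; have [x0 V0] := (regular_domainP k3 a0 x).1 rx.
apply: differentiable_mul; first exact: (twistor_metric_hol gP rx).
exact: differentiable_potential.
Qed.

Lemma Sigma1E y : regular_domain k a y ->
  Sigma k a 1 y = P y *m (a *: skew_gram C) *m (P y)^T.
Proof.
move=> ry; have [y0 V0] := (regular_domainP k3 a0 y).1 ry.
apply/matrixP => i j; rewrite Sigma_entry // -scalemxAr -scalemxAl mxE.
by rewrite congr_entry skew_gramE !coframe_mxE.
Qed.

(** Sigma_1 has constant coefficients in the coframe in which the metric is
    conformal_factor times a constant form. *)
Lemma pd_conformal_factor x i : regular_domain k a x -> pd i conformal_factor x = 0.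
Proof.
move=> rx; have [x0 V0] := (regular_domainP k3 a0 x).1 rx.
pose v : 'rV[C]_4 := delta_mx 0 i.
pose dP : 'M[C]_4 := \matrix_(j, l) 'D_v (fun y => P y j l) x.
have hP : is_mx_derive x v P dP.
  move=> j l; rewrite mxE; apply/derivableP/diff_derivable.
  under eq_fun do rewrite mxE; exact: differentiable_coframe.
have hf : is_derive x v conformal_factor (pd i conformal_factor x).
  exact/derivableP/diff_derivable/differentiable_conformal_factor.
have near_r := near_regular k3 a0 rx.
have eS : pd_mx (Sigma k a 1) x i = dP *m (a *: skew_gram C) *m (P x)^T
    + P x *m (a *: skew_gram C) *m dP^T.
  apply/matrixP => j l; rewrite mxE.
  have h := is_mx_derive_congr (a *: skew_gram C) hP j l.
  rewrite -(@derive_val _ _ _ _ _ _ _ h); apply: near_eq_derive.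
  by near=> y; rewrite Sigma1E //; near: y.
have eg : pd_mx g x i = pd i conformal_factor x *: (P x *m J *m (P x)^T)
    + conformal_factor x *: (dP *m J *m (P x)^T + P x *m J *m dP^T).
  apply/matrixP => j l; rewrite mxE.
  have h := is_derive_mul hf (is_mx_derive_congr J hP j l).
  have entry b c (A B : 'M[C]_4) : (b *: A + c *: B) j l = c * B j l + b * A j l.
    by rewrite !mxE addrC.
  have entry1 b (A : 'M[C]_4) : (b *: A) j l = b * A j l by rewrite mxE.
  rewrite entry.
  rewrite -(@derive_val _ _ _ _ _ _ _ h); apply: near_eq_derive.
  by near=> y; rewrite [in LHS]metric_factor ?entry1 //; near: y.
have uK : a *: skew_gram C \in unitmx by rewrite unitmxZ ?unitfE // skew_gram_unit.
apply: (@conformal_factor_rigid _ _ (P x) dP (connection x i) J _ (conformal_factor x) _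
  (coframe_mx_unit x0 V0) (null_gram_unit C) uK).
- rewrite -eS -(Sigma1E rx); apply/matrixP => j l; rewrite !mxE.
  have := twistor_metric_parallel gP rx (isT : (1 < 3)%N) i j l.
  move/eqP; rewrite subr_eq0 subr_eq addrC => /eqP ->.
  by congr (_ + _); apply: eq_bigr => m _; rewrite ?mxE // mulrC.
- by rewrite -eg metric_compatible // metric_factor // scalerDr -!scalemxAl -!scalemxAr.
Unshelve. all: by end_near. Qed.

Lemma coframe_shift x v n (h : C) :
  coframe k (h *: delta_mx 0 3 + x) v n = coframe k x v n.
Proof.
have e (j : 'I_4) : j != 3 -> (h *: delta_mx 0 3 + x) 0 j = x 0 j.
  by move=> j3; rewrite !mxE /= (negbTE j3) mulr0 add0r.
rewrite /coframe /theta /potential /inv_coef /sq_coef /dsq_coef /=.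
by rewrite !(e 0) // !(e 1) // !(e 2).
Qed.

Lemma regular_shift x (h : C) : regular_domain k a x ->
  regular_domain k a (h *: delta_mx 0 3 + x).
Proof.
move=> rx; have [x0 V0] := (regular_domainP k3 a0 x).1 rx.
have e (j : 'I_4) : j != 3 -> (h *: delta_mx 0 3 + x) 0 j = x 0 j.
  by move=> j3; rewrite !mxE /= (negbTE j3) mulr0 add0r.
apply/(regular_domainP k3 a0); rewrite e // /potential /inv_coef /sq_coef /=.
by rewrite !(e 0) // !(e 1) // !(e 2).
Qed.

Lemma lie_Kfield (S : 'rV[C]_4 -> 'M[C]_4) x :
  (forall i j, is_derive x (delta_mx 0 3) (fun y => S y i j) 0) ->
  lie (@Kfield C) S x = 0.
Proof.
move=> dS; apply/matrixP => i j; rewrite !mxE big1 // => l _.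
have dK m n : pd m (fun y => @Kfield C y 0 n) x = 0.
  exact: (@derive_val _ _ _ _ _ _ _ (is_derive_const _ _ _)).
rewrite !dK !mulr0 !addr0 !mxE /=; have [->|_] := eqVneq l 3; last by rewrite mul0r.
by rewrite /pd (@derive_val _ _ _ _ _ _ _ (dS i j)) mulr0.
Qed.

Lemma killing x : regular_domain k a x -> lie (@Kfield C) g x = 0.
Proof.
move=> rx; apply: lie_Kfield => i j.
have hf : is_derive x (delta_mx 0 3) conformal_factor (pd 3 conformal_factor x).
  exact/derivableP/diff_derivable/differentiable_conformal_factor.
have hG : is_derive x (delta_mx 0 3) (fun y => (P y *m J *m (P y)^T) i j) 0.
  apply: is_derive_const_along; near=> h.
  have -> // : P (h *: delta_mx 0 3 + x) = P x.
  by apply/matrixP => p q; rewrite !mxE coframe_shift.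
have h := is_derive_mul hf hG.
rewrite mulr0 add0r (pd_conformal_factor 3 rx) mul0r in h.
apply: near_eq_is_derive h; near=> y.
rewrite [in RHS]metric_factor; first by rewrite [RHS]mxE.
by near: y; exact: near_regular.
Unshelve. all: by end_near. Qed.

Lemma triholomorphic x n : regular_domain k a x -> (n < 3)%N ->
  lie (@Kfield C) (Sigma k a n) x = 0.
Proof.
move=> rx n3; apply: lie_Kfield => i j.
apply: is_derive_const_along; near=> h.
have [x0 V0] := (regular_domainP k3 a0 _).1 rx.
have [y0 W0] := (regular_domainP k3 a0 _).1 (regular_shift h rx).
by rewrite !Sigma_entry // /sigma_form !coframe_shift.
Unshelve. all: by end_near. Qed.

End Metric.

(** * Connectedness of the regular domain *)

Section LocallyConstant.
Variable R : realType.
Local Notation C := (Cplx R).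
Local Notation toC := (real_complex R : R -> C).
Local Notation Re := (@complex.Re R).
Local Notation Im := (@complex.Im R).
Local Notation imag := (complex.Complex (0 : R) 1 : C).

(** Real parts of complex difference quotients converge when the quotients do. *)
Lemma Re_le_norm (z : C) : toC `|Re z| <= `|z|.
Proof.
rewrite normc_def lecR -sqrtr_sqr ler_wsqrtr // lerDl; exact: sqr_ge0.
Qed.

Lemma norm_toC (t : R) : `|toC t| = toC `|t|.
Proof. by rewrite normc_def /= expr0n addr0 sqrtr_sqr. Qed.

Lemma ReB (z w : C) : Re (z - w) = Re z - Re w.
Proof. by case: z w => [? ?] [? ?]. Qed.

Lemma Re_toCM (t : R) (z : C) : Re (toC t * z) = t * Re z.
Proof. by case: z => [u v] /=; rewrite mul0r subr0. Qed.

Lemma Re_constant_on_reals (F : C -> C) (s t : R) :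
  (forall t : R, is_derive (toC t) 1 F 0) -> Re (F (toC s)) = Re (F (toC t)).
Proof.
move=> dF; apply: (@is_derive_0_is_cst _ (fun t => Re (F (toC t)))) => {s}t.
pose q (h : C) := h^-1 * (F (h * 1 + toC t) - F (toC t)).
have qC : q @ 0^' --> (0 : C).
  have [d e] := dF t; have : q @ 0^' --> 'D_1 F (toC t) by exact: d.
  by rewrite e.
have lim0 : (fun h : R => Re (q (toC h))) @ 0^' --> (0 : R).
  apply/cvgrPdist_lt => e e0.
  have e0' : 0 < toC e by rewrite ltcR.
  have /cvgrPdist_lt/(_ _ e0')[d /= d0 Hd] := qC.
  have dE : toC (Re d) = d by apply: RRe_real; rewrite gtr0_real.
  exists (Re d); first by rewrite /= -ltcR dE.
  move=> h /=; rewrite sub0r normrN => hd h0.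
  have := Hd (toC h); rewrite /= !sub0r !normrN.
  rewrite norm_toC -dE ltcR => /(_ hd) H.
  rewrite -ltcR; apply: le_lt_trans (Re_le_norm _) _; apply: H.
  by apply: contra_neq h0 => /complexI.
apply: (is_derive_slope _ lim0).
near=> h; rewrite /q /= [h *: 1]mulr1 mulr1.
by rewrite -fmorphV Re_toCM ReB rmorphD.
Unshelve. all: by end_near. Qed.

(** The real and the imaginary part have zero derivative along the real line. *)
Lemma constant_on_reals (F : C -> C) (s t : R) :
  (forall t : R, is_derive (toC t) 1 F 0) -> F (toC s) = F (toC t).
Proof.
move=> dF; have e1 := Re_constant_on_reals s t dF.
have dG u : is_derive (toC u) 1 (fun z => imag * F z) 0.
  by rewrite -(mulr0 imag); exact: is_derive_scale.
have e2 := Re_constant_on_reals s t dG.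
move: e1 e2; case: (F _) (F _) => [u v] [u' v'] /= ->.
by rewrite !mul0r !mul1r !sub0r => /oppr_inj ->.
Qed.

(** Every point other than 0 and 1 lies on at most one of the curves
    t + i c t (1 - t) with c real. *)
Lemma avoiding_parabola (rs : seq C) : 0 \notin rs -> 1 \notin rs ->
  exists c : C, forall t : R, toC t + c * toC t * (1 - toC t) \notin rs.
Proof.
move=> rs0 rs1.
(* the parabola t + i c t (1 - t) meets z only if Re z = t and c = b z *)
pose b (z : C) := Im z / (Re z * (1 - Re z)).
have [c cb] : exists c : R, forall z, z \in rs -> b z < c.
  elim: rs {rs0 rs1} => [|z rs [c IH]]; first by exists 0.
  exists (Num.max c (b z + 1)) => w; rewrite inE => /orP[/eqP ->|/IH w_c].
    by rewrite lt_max ltrDl ltr01 orbT.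
  by rewrite lt_max w_c.
exists (imag * toC c) => t; apply/negP.
set z := (_ + _); move=> zrs.
have zE : z = Complex t (c * t * (1 - t)).
  rewrite /z; apply/eqP; rewrite eq_complex /=; apply/andP; split; apply/eqP; simpc; ring.
have [t0|t0] := eqVneq (t * (1 - t)) 0.
  have /eqP := t0; rewrite mulf_eq0 subr_eq0 => /orP[]/eqP t01.
    by move: zrs rs0; rewrite zE -mulrA t0 mulr0 t01 => ->.
  by move: zrs rs1; rewrite zE -mulrA t0 mulr0 -t01 => ->.
have := cb _ zrs; rewrite zE /b /= -[c * t * _]mulrA mulfK //.
by rewrite ltxx.
Qed.

Lemma diff_eq0 n (f : 'rV[C]_n -> C) (x v : 'rV[C]_n) :
  differentiable f x -> (forall i, pd i f x = 0) -> 'd f x v = 0.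
Proof.
move=> df f0; rewrite [v]row_sum_delta linear_sum big1 // => i _.
rewrite linearZ /= -deriveE //.
by have := f0 i; rewrite /pd => ->; rewrite scaler0.
Qed.

End LocallyConstant.

Section PolynomialCoefficients.
Variables (C : numClosedFieldType).

(** Multiplying s_n by q_0^(n + 1/2) clears its denominators. *)
Lemma isqrt_coef_poly (u b c : {poly C}) n : exists p : {poly C}, forall l,
  u.[l] != 0 ->
  p.[l] = u.[l] ^+ (n.*2.+1) * isqrt_coef u.[l]^-1 b.[l] c.[l] n.
Proof.
elim/ltn_ind: n => -[|n] IH.
  by exists 1 => l ul; rewrite hornerC expr1 isqrt_coef0 mulfV.
have [p pE] := IH n (ltnSn n).
have [p' p'E] : exists p', forall l, u.[l] != 0 -> p'.[l] =
    n%:R * (u.[l] ^+ n.*2.+1 * isqrt_coef u.[l]^-1 b.[l] c.[l] n.-1).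
  case: n IH {p pE} => [|n] IH; first by exists 0 => l _; rewrite horner0 mul0r.
  have [|p pE] := IH n; first by lia.
  exists (n.+1%:R *: (u ^+ 2 * p)) => l ul.
  by rewrite hornerZ hornerM horner_exp pE // doubleS !exprS; ring.
exists (- (n.+1%:R)^-1 *: ((n%:R + 2^-1) *: (b * p) + c * p')) => l ul.
rewrite hornerZ hornerD hornerZ !hornerM pE // p'E // isqrt_coefS doubleS !exprS.
have n1 : n.+1%:R != 0 :> C by rewrite pnatr_eq0.
move: n1; rewrite -natr1 expr0 => n1.
move: (isqrt_coef _ _ _ n) (isqrt_coef _ _ _ n.-1) (u.[l] ^+ n.*2) => y y' w.
by field; rewrite ul n1.
Qed.

End PolynomialCoefficients.

Section GlobalFactor.
Variables (R : realType) (k : nat) (a : Cplx R).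
Local Notation C := (Cplx R).
Hypotheses (k3 : (3 <= k)%N) (a0 : a != 0).
Implicit Types (x y w : 'rV[C]_4).

(** On the chart the regular domain is the complement of the zero set of x_0
    times a polynomial. *)
Lemma regular_on_line x w : exists p : {poly C}, forall z,
  (p.[z] != 0) <-> regular_domain k a (x + z *: w).
Proof.
pose lin i : {poly C} := (x 0 i)%:P + (w 0 i) *: 'X.
have linE i z : (lin i).[z] = (x + z *: w) 0 i.
  by rewrite hornerD hornerC hornerZ hornerX !mxE mulrC.
pose b := 2%:P * lin 0 * lin 1.
pose c := lin 1 ^+ 2 + 2%:P * lin 0 * lin 2.
have [p pE] := isqrt_coef_poly (lin 0) b c (k - 1).
exists (lin 0 * p) => z; rewrite (regular_domainP k3 a0) hornerM -linE.
split=> [|[x0 V0]].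
  rewrite mulf_eq0 negb_or => /andP[x0 p0]; split=> //.
  move: p0; rewrite pE // mulf_eq0 negb_or => /andP[_].
  rewrite /potential /inv_coef /sq_coef /= -!linE /b /c.
  rewrite !(hornerD, hornerM, hornerC, horner_exp) => s0.
  by rewrite mulf_neq0 // invr_eq0 pnatr_eq0.
rewrite mulf_neq0 // pE // mulf_neq0 ?expf_neq0 //.
move: V0; rewrite /potential /inv_coef /sq_coef /= -!linE /b /c.
rewrite !(hornerD, hornerM, hornerC, horner_exp).
by rewrite mulf_eq0 negb_or => /andP[].
Qed.

(** The regular domain is the complement of an algebraic hypersurface, hence
    connected by real parabolas inside complex lines. *)
Lemma constant_on_regular_domain (f : 'rV[C]_4 -> C) x y :
  (forall z, regular_domain k a z -> differentiable f z) ->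
  (forall z i, regular_domain k a z -> pd i f z = 0) ->
  regular_domain k a x -> regular_domain k a y -> f x = f y.
Proof.
move=> df f0 rx ry; pose w := y - x.
have [p pE] := regular_on_line x w.
have p0 : p.[0] != 0 by apply/pE; rewrite scale0r addr0.
have p1 : p.[1] != 0 by apply/pE; rewrite scale1r subrKC.
have pn0 : p != 0 by apply: contraNneq p0 => ->; rewrite horner0.
have [rs rsE] := closed_field_poly_normal p.
have rsP z : root p z = (z \in rs).
  by rewrite {1}rsE rootZ ?lead_coef_eq0 // root_prod_XsubC.
have [c cP] : exists c : C, forall t : R,
    real_complex R t + c * real_complex R t * (1 - real_complex R t) \notin rs.
  by apply: avoiding_parabola; rewrite -rsP.
pose zeta (z : C) := z + c * z * (1 - z).
pose L (z : C) := x + zeta z *: w.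
have dL (z : C) : differentiable L z.
  apply: differentiableD; first exact: differentiable_cst.
  apply: differentiableZl.
  by apply: differentiable_add.
have rL (t : R) : regular_domain k a (L (real_complex R t)).
  by apply/pE; have := cP t; rewrite -rsP.
have dF (t : R) : is_derive (real_complex R t : C) 1 (fun z => f (L z)) 0.
  have d : differentiable (fun z => f (L z)) (real_complex R t : C).
    by apply: differentiable_comp => //; exact/df/rL.
  apply: DeriveDef; first exact: diff_derivable.
  rewrite deriveE // [X in X _ = _](diff_comp (dL _) (df _ (rL t))) /=.
  by apply: diff_eq0 => [|i]; [exact/df/rL|exact/f0/rL].
have L0 : L (real_complex R 0) = x.
  by rewrite /L /zeta rmorph0 mulr0 mul0r addr0 scale0r addr0.
have L1 : L (real_complex R 1) = y.
  by rewrite /L /zeta rmorph1 subrr mulr0 addr0 scale1r subrKC.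
by have := constant_on_reals 0 1 dF; rewrite L0 L1.
Qed.

End GlobalFactor.

(** * Gibbons-Hawking forms and the potential *)

Section GibbonsHawkingAlgebra.
Variable C : numClosedFieldType.
Implicit Types (c V vol : C) (A : 'rV[C]_3) (F : 'M[C]_3).

Lemma row_mul3 n (u : 'rV[C]_3) (M : 'M[C]_(3, n)) j :
  (u *m M) 0 j = u 0 0 * M 0 j + u 0 1 * M 1 j + u 0 2 * M 2 j.
Proof. by rewrite mxE sum3. Qed.

Lemma gibbons_hawkingE c V A (u w : 'rV[C]_4) :
  (u *m gibbons_hawking (h_flat c) V A *m w^T) 0 0 =
  V * c * (u 0 0 * w 0 0 - u 0 1 * w 0 1 - u 0 2 * w 0 2)
  + V^-1 * (A 0 0 * u 0 0 + A 0 1 * u 0 1 + A 0 2 * u 0 2 + u 0 3)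
         * (A 0 0 * w 0 0 + A 0 1 * w 0 1 + A 0 2 * w 0 2 + w 0 3).
Proof.
rewrite /gibbons_hawking; set B := block_mx _ _ _ _; set th := row_mx _ _.
have sub (z : 'rV[C]_(3 + 1)) : (z *m th^T) 0 0 =
    A 0 0 * z 0 0 + A 0 1 * z 0 1 + A 0 2 * z 0 2 + z 0 3.
  rewrite -[z in LHS]hsubmxK tr_row_mx mul_row_col trmx1 mulmx1 mxE row_mul3 !mxE.
  rewrite (_ : lshift 1 0 = 0); last exact/val_inj.
  rewrite (_ : lshift 1 1 = 1); last exact/val_inj.
  rewrite (_ : lshift 1 2 = 2); last exact/val_inj.
  rewrite (_ : rshift 3 0 = 3); last exact/val_inj.
  by ring.
have main : (u : 'rV_(3 + 1)) *m B *m (w : 'rV_(3 + 1))^T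
    = lsubmx (u : 'rV_(3 + 1)) *m h_flat c *m (lsubmx (w : 'rV_(3 + 1)))^T.
  rewrite -[u in LHS](@hsubmxK _ 1 3 1) -[w in LHS](@hsubmxK _ 1 3 1).
  by rewrite mul_row_block !mulmx0 !addr0 tr_row_mx mul_row_col mul0mx addr0.
rewrite mulmxDr mulmxDl -!scalemxAr -!scalemxAl main mxE.
rewrite [X in X + _]mxE [X in _ + X]mxE; congr (_ + _).
  rewrite row_mul3 -mulrA; congr (_ * _).
  rewrite !row_mul3 !mxE /=.
  rewrite (_ : lshift 1 0 = 0); last exact/val_inj.
  rewrite (_ : lshift 1 1 = 1); last exact/val_inj.
  rewrite (_ : lshift 1 2 = 2); last exact/val_inj.
  by ring.
rewrite -mulrA -!sub; congr (_ * _).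
have -> : u *m (th^T *m th) *m w^T = (u *m th^T) *m (w *m th^T)^T.
  by rewrite trmx_mul trmxK !mulmxA.
by rewrite mxE big_ord1 [X in _ * X]mxE.
Qed.

Lemma invmx_h_flat c : c != 0 ->
  invmx (h_flat c) = c^-1 *: diag_mx (\row_(i < 3) (if i == 0 then 1 else -1)).
Proof.
move=> c0; set D := diag_mx _.
have h : h_flat c *m (c^-1 *: D) = 1%:M.
  rewrite -scalemxAr -scalemxAl scalerA mulVf // scale1r mulmx_diag.
  by apply/matrixP => i j; rewrite !mxE; case: (i == 0); rewrite ?mulrNN mulr1.
have [u _] := mulmx1_unit h.
by rewrite -[RHS](mulKmx u) h mulmx1.
Qed.

Lemma det_h_flat c : \det (h_flat c) = c ^+ 3.
Proof.
rewrite detZ det_diag !big_ord_recl big_ord0 !mxE /=; ring.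
Qed.

Lemma hodgeE c vol F : c != 0 -> F^T = - F ->
  hodge (h_flat c) vol F = (vol / c ^+ 2) *: \row_i [:: F 1 2; F 0 2; - F 0 1]`_i.
Proof.
move=> c0 Fs; have sk i j : F j i = - F i j by have /matrixP/(_ i j) := Fs; rewrite !mxE.
have e j l : (invmx (h_flat c) *m F *m (invmx (h_flat c))^T) j l
    = (c^-1 * (if j == 0 then 1 else -1)) * (c^-1 * (if l == 0 then 1 else -1)) * F j l.
  rewrite invmx_h_flat // linearZ /= tr_diag_mx -!scalemxAl -!scalemxAr.
  by rewrite mul_mx_diag mul_diag_mx !mxE; ring.
have [i0E i1E i2E] : [/\ (0 : 'I_3) = 0%N :> nat, (1 : 'I_3) = 1%N :> nat
  & (2 : 'I_3) = 2%N :> nat] by [].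
apply/rowP; apply: forall_ord3; rewrite !mxE !sum3 !e /eps3 ?i0E ?i1E ?i2E /=.
all: rewrite (sk 0 1) (sk 0 2) (sk 1 2); by field.
Qed.

End GibbonsHawkingAlgebra.

Lemma is_derive_comp1 (K : numFieldType) (f h : K -> K) (l df dh : K) :
  is_derive l 1 h dh -> is_derive (h l) 1 f df ->
  is_derive l 1 (fun t => f (h t)) (df * dh).
Proof.
move=> [dh' he] [df' fe].
have Dh : differentiable h l by exact/derivable1_diffP.
have Df : differentiable f (h l) by exact/derivable1_diffP.
have he' : 'd h l 1 = dh by rewrite -he deriveE.
have fe' z : 'd f (h l) z = z * df by rewrite deriv1E // derive1E fe.
have Dfh : differentiable (fun t => f (h t)) l := differentiable_comp Dh Df.
apply: DeriveDef; first exact/derivable1_diffP.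
transitivity ('d (fun t => f (h t)) l 1); first exact: deriveE Dfh.
transitivity ('d f (h l) ('d h l 1)).
  exact: (congr1 (fun F : K -> K => F 1) (diff_comp Dh Df)).
exact: etrans (congr1 ('d f (h l)) he') (etrans (fe' dh) (mulrC dh df)).
Qed.

Section PotentialBranch.
Variables (C : numClosedFieldType) (k : nat) (r0 : C).
Hypothesis k3 : (3 <= k)%N.
Implicit Types (w v : 'rV[C]_3) (l : C).

Definition sqrtXY w : C := near_sqrt r0 (w 0 0 + w 0 1).

Definition near_branch w : Prop := `|sqrtXY w - r0| < `|sqrtXY w + r0|.

Definition gh_coef w n : C := isqrt_coef (sqrtXY w)^-1 (2 * w 0 2) (w 0 0 - w 0 1) n.

(** The branch of quadric^(-1/2) that is 1 / r at l = 0. *)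
Definition branch w l : C := (near_sqrt (sqrtXY w) (quadric w l))^-1.

Definition gh_V w : C := gh_coef w (k - 1) / 2.

(** The connection form of theta = dT + A in the rescaled coordinates, where
    dq_1 = 2 dZ and dq_2 = dX - dY. *)
Definition gh_A (m : C) w : 'rV[C]_3 :=
  (2 * m)^-1 *: \row_(i < 3)
     [:: - gh_coef w (k - 2); gh_coef w (k - 2); - gh_coef w (k - 1)]`_i.

Lemma sqrtXY_sq w : sqrtXY w ^+ 2 = w 0 0 + w 0 1.
Proof. exact: near_sqrt_sq. Qed.

Lemma sqrtXY_neq0 w : near_branch w -> sqrtXY w != 0.
Proof. exact: near_sqrt_neq0. Qed.

Lemma differentiable_XY w : differentiable (fun w : 'rV[C]_3 => w 0 0 + w 0 1) w.
Proof. by apply: differentiable_add; exact: differentiable_coord. Qed.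

Lemma differentiable_sqrtXY w : near_branch w -> differentiable sqrtXY w.
Proof.
move=> nb; apply: (differentiable_comp (differentiable_XY w)).
by apply/derivable1_diffP; have [] := is_derive_near_sqrt nb.
Qed.

Lemma near_near_branch w : near_branch w -> \forall w' \near w, near_branch w'.
Proof.
move=> nb; have c := differentiable_continuous (differentiable_XY w).
exact: c _ (near_sqrt_near nb).
Qed.

Lemma differentiable_gh_coef w n : near_branch w -> differentiable (fun w => gh_coef w n) w.
Proof.
move=> nb; apply: differentiable_isqrt_coef.
- by apply: differentiableV; [exact: differentiable_sqrtXY|exact: sqrtXY_neq0].
- by apply: differentiable_mul; [exact: differentiable_const|exact: differentiable_coord].
- by apply: differentiable_add; last apply: differentiable_opp; exact: differentiable_coord.
Qed.

Lemma differentiable_gh_V w : near_branch w -> differentiable gh_V w.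
Proof.
move=> nb; apply: differentiable_mul; first exact: differentiable_gh_coef.
exact: differentiable_const.
Qed.

Definition gh_series w : {poly C} := \poly_(n < k) gh_coef w n.

Definition quadric_poly w : {poly C} := quad (w 0 0 + w 0 1) (2 * w 0 2) (w 0 0 - w 0 1).

Lemma gh_series_sq w : near_branch w ->
  'X^k %| gh_series w ^+ 2 * quadric_poly w - 1.
Proof.
move=> nb; have := isqrt_sq (2 * w 0 2) (w 0 0 - w 0 1) k (invr_neq0 (sqrtXY_neq0 nb)).
by rewrite exprVn invrK sqrtXY_sq.
Qed.

(** Differentiating S^2 q = 1 gives dS = - S^3 dq / 2. *)
Lemma is_derive_gh_coef w v n : near_branch w -> (n < k)%N ->
  is_derive w v (fun w => gh_coef w n)
    (- 2^-1 * (quadric_poly v * gh_series w ^+ 3)`_n).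
Proof.
move=> nb nk; set S := gh_series w.
have dS : is_poly_derive w v gh_series (\poly_(n < k) 'D_v (fun w => gh_coef w n) w).
  by apply: is_poly_derive_poly => i _; apply/derivableP/diff_derivable/differentiable_gh_coef.
set dSw := \poly_(n < k) _ in dS.
have d i := is_derive_coord w v 0 i.
have dq : is_poly_derive w v quadric_poly (quadric_poly v).
  by apply: is_poly_derive_quad.
have d1 : is_poly_derive w v (fun=> 1 : {poly C}) 0.
  by move=> i; rewrite coef0; exact: is_derive_const.
have near_nb := near_near_branch nb.
have := is_poly_derive_mod (n := k) (is_poly_derive_mul (is_poly_derive_mul dS dS) dq) d1.
rewrite subr0 -/S => /(_ _)/wrap[].
  by near=> w'; rewrite -expr2; apply: gh_series_sq; near: w'.
move=> e.
have {}e : 'X^k %| 2 *: dSw + quadric_poly v * S ^+ 3.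
  have s1 := gh_series_sq nb; rewrite -/S in s1.
  rewrite (_ : _ + _ = S * (S * S * quadric_poly v + (S * dSw + dSw * S) * quadric_poly w)
     - 2 *: dSw * (S ^+ 2 * quadric_poly w - 1)); last by rewrite scaler_nat; ring.
  by rewrite dvdp_sub ?dvdp_mull.
have /dvdXnP/(_ n nk) := e.
have := derivableP (diff_derivable (differentiable_gh_coef n nb)).
rewrite coefD coefZ coef_poly nk => dn en.
apply: (is_derive_eq (dn v)).
have n20 : 2 != 0 :> C by rewrite pnatr_eq0.
apply: (mulfI n20); rewrite mulNr mulrN mulVKf //.
by apply/eqP; rewrite -addr_eq0 en.
Unshelve. all: by end_near. Qed.

Lemma derivable_quadric w l : is_derive l 1 (quadric w) (2 * w 0 2 + 2 * (w 0 0 - w 0 1) * l).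
Proof.
have di : is_derive l (1 : C) id 1 by exact: is_derive_id.
have d2 := is_derive_mul di di.
have d := is_derive_add (is_derive_add (is_derive_scale (w 0 0 - w 0 1) d2)
  (is_derive_scale (2 * w 0 2) di)) (is_derive_const l 1 (w 0 0 + w 0 1)).
have -> : quadric w =
    fun y => (w 0 0 - w 0 1) * (y * y) + 2 * w 0 2 * y + (w 0 0 + w 0 1).
  by apply/funext => y; rewrite /quadric; ring.
by apply: (is_derive_eq d); ring.
Qed.

Definition branch_domain w : set C :=
  [set l | `|near_sqrt (sqrtXY w) (quadric w l) - sqrtXY w|
           < `|near_sqrt (sqrtXY w) (quadric w l) + sqrtXY w|].

Lemma near_sqrt_self (u : C) : u != 0 -> near_sqrt u (u ^+ 2) = u.
Proof.
move=> u0; apply: near_sqrt_uniq => //.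
by rewrite subrr normr0 normr_gt0 -mulr2n mulrn_eq0.
Qed.

Lemma quadric0 w : quadric w 0 = sqrtXY w ^+ 2.
Proof. by rewrite sqrtXY_sq /quadric expr0n /= !(mulr0, mul0r) !add0r. Qed.

Lemma branch_domain0 w : near_branch w -> branch_domain w 0.
Proof.
move=> /sqrtXY_neq0 u0; rewrite /branch_domain /= quadric0 near_sqrt_self //.
by rewrite subrr normr0 normr_gt0 -mulr2n mulrn_eq0.
Qed.

Lemma branch_domain_open w : open (branch_domain w).
Proof.
rewrite openE => l Ol.
have [dq _] := derivable_quadric w l.
have c : {for l, continuous (quadric w)}.
  by apply: differentiable_continuous; apply/derivable1_diffP.
exact: c _ (near_sqrt_near Ol).
Qed.

Lemma is_derive_branch w l : branch_domain w l ->
  is_derive l 1 (branch w)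
    (- 2^-1 * (2 * w 0 2 + 2 * (w 0 0 - w 0 1) * l) * branch w l ^+ 3).
Proof.
move=> Ol; have z0 := near_sqrt_neq0 Ol.
have dz := is_derive_comp1 (derivable_quadric w l) (is_derive_near_sqrt Ol).
have d := @is_derive_inv _ _ (fun t => near_sqrt (sqrtXY w) (quadric w t)) _ _ _ z0 dz.
apply: (is_derive_eq d); rewrite /branch.
by move: (near_sqrt _ _) z0 => z z0; field.
Qed.

Lemma branch_sqrt w : near_branch w ->
  [/\ holomorphic_at sqrtXY w, sqrtXY w ^+ 2 = w 0 0 + w 0 1,
      branch w 0 = (sqrtXY w)^-1 &
      \forall l \near (0 : C), derivable (branch w) l 1 /\ branch w l ^+ 2 * quadric w l = 1].
Proof.
move=> nb; split; first exact: differentiable_sqrtXY.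
- exact: sqrtXY_sq.
- by rewrite /branch quadric0 near_sqrt_self // sqrtXY_neq0.
near=> l; have Ol : branch_domain w l.
  by near: l; exact: open_nbhs_nbhs (conj (@branch_domain_open w) (branch_domain0 nb)).
split; first by have [] := is_derive_branch Ol.
have z0 := near_sqrt_neq0 Ol.
by rewrite /branch exprVn near_sqrt_sq mulVf // -(near_sqrt_sq (sqrtXY w) (quadric w l)) expf_neq0.
Unshelve. all: by end_near. Qed.

Lemma gh_V_potential w : near_branch w -> gh_V w = GH_potential k (branch w).
Proof.
move=> nb; have dB l Ol := @is_derive_branch w l Ol.
rewrite /GH_potential (derive1n_isqrt (k - 1) (@branch_domain_open w) dB (branch_domain0 nb)).
have -> : branch w 0 = (sqrtXY w)^-1 by have [] := branch_sqrt nb.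
rewrite mulr0 addr0 /gh_V /gh_coef.
have n0 : ((k - 1)`!)%:R != 0 :> C by rewrite pnatr_eq0 -lt0n fact_gt0.
by move: n0 (isqrt_coef _ _ _ _) => n0 s; field.
Qed.

Lemma gh_V3 w : k = 3%N -> near_branch w ->
  gh_V w = - (w 0 0 ^+ 2 - w 0 1 ^+ 2 - 3 * w 0 2 ^+ 2) / (4 * sqrtXY w ^+ 5).
Proof.
move=> kE nb; have r0' := sqrtXY_neq0 nb.
rewrite /gh_V /gh_coef kE -[(3 - 1)%N]/2%N !isqrt_coefS isqrt_coef0 /=.
have e : w 0 0 = sqrtXY w ^+ 2 - w 0 1 by rewrite sqrtXY_sq addrK.
by rewrite e; field.
Qed.

Lemma gh_V4 w : k = 4%N -> near_branch w ->
  gh_V w = w 0 2 * (3 * w 0 0 ^+ 2 - 3 * w 0 1 ^+ 2 - 5 * w 0 2 ^+ 2) / (4 * sqrtXY w ^+ 7).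
Proof.
move=> kE nb; have r0' := sqrtXY_neq0 nb.
rewrite /gh_V /gh_coef kE -[(4 - 1)%N]/3%N !isqrt_coefS isqrt_coef0 /=.
have e : w 0 0 = sqrtXY w ^+ 2 - w 0 1 by rewrite sqrtXY_sq addrK.
by rewrite e; field.
Qed.

(** With u_n the coefficients of q^(-3/2), the derivative of s_n is
    - (u_n dq_0 + u_(n-1) dq_1 + u_(n-2) dq_2) / 2. *)
Lemma gh_coef_derivatives w : near_branch w -> exists u1 u2 u3 u4 : C, forall v,
  is_derive w v (fun w => gh_coef w (k - 1))
    (- 2^-1 * ((v 0 0 + v 0 1) * u1 + 2 * v 0 2 * u2 + (v 0 0 - v 0 1) * u3)) /\
  is_derive w v (fun w => gh_coef w (k - 2))
    (- 2^-1 * ((v 0 0 + v 0 1) * u2 + 2 * v 0 2 * u3 + (v 0 0 - v 0 1) * u4)).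
Proof.
move=> nb; set u := gh_series w ^+ 3.
exists u`_(k - 1), u`_(k - 2), u`_(k - 3), (if (k - 2)%N is m.+2 then u`_m else 0).
move=> v; split.
  have d : is_derive w v _ _ := @is_derive_gh_coef w v (k - 1) nb ltac:(lia).
  apply: (is_derive_eq d); rewrite -/u /quadric_poly coef_quadM_ge2; last by lia.
  have -> : (k - 1 - 1 = k - 2)%N by lia.
  by have -> : (k - 1 - 2 = k - 3)%N by lia.
have d : is_derive w v _ _ := @is_derive_gh_coef w v (k - 2) nb ltac:(lia).
apply: (is_derive_eq d); rewrite -/u /quadric_poly coef_quadM.
case kE : (k - 2)%N => [|n]; first by lia.
by have -> : (k - 3 = n)%N by lia.
Qed.

Lemma gh_A_holomorphic (m : C) w i : near_branch w ->
  holomorphic_at (fun w' => gh_A m w' 0 i) w.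
Proof.
move=> nb; rewrite /holomorphic_at /gh_A; under eq_fun do rewrite !mxE.
apply: differentiable_mul; first exact: differentiable_const.
have d n := differentiable_gh_coef n nb.
elim/forall_ord3: i => //=; exact: differentiable_opp.
Qed.

(** The monopole equation.  It reduces to d s_(k-1) / d q_(i+1) =
    d s_(k-2) / d q_i for the coefficients s_n of (q_0 + q_1 l + q_2 l^2)^(-1/2). *)
Lemma monopole (m : C) w : m != 0 -> near_branch w ->
  grad gh_V w = hodge (h_flat (m ^- 2)) (- m ^- 3) (ext_d (gh_A m) w).
Proof.
move=> m0 nb; have m20 : m ^- 2 != 0 by rewrite invr_eq0 expf_neq0.
rewrite hodgeE //; last by apply/matrixP => i j; rewrite !mxE opprB.
have [u1 [u2 [u3 [u4 D]]]] := gh_coef_derivatives nb.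
pose q (u u' u'' : C) (i : 'I_3) : C := let v : 'rV[C]_3 := delta_mx 0 i in
  (v 0 0 + v 0 1) * u + 2 * v 0 2 * u' + (v 0 0 - v 0 1) * u''.
have dV i : pd i gh_V w = 2^-1 * (- 2^-1 * q u1 u2 u3 i).
  have [d _] := D (delta_mx 0 i).
  have d' := is_derive_mul d (is_derive_const w (delta_mx 0 i) (2^-1 : C)).
  by rewrite /pd (@derive_val _ _ _ _ _ _ _ d') mulr0 add0r mulrC.
have dA i j : pd i (fun y => gh_A m y 0 j) w = (2 * m)^-1 *
    (- 2^-1 * [:: - q u2 u3 u4 i; q u2 u3 u4 i; - q u1 u2 u3 i]`_j).
  have [d1 d2] := D (delta_mx 0 i).
  rewrite /pd /gh_A; under eq_fun do rewrite !mxE.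
  elim/forall_ord3: j => /=.
  - rewrite (@derive_val _ _ _ _ _ _ _ (is_derive_scale (2 * m)^-1 (is_derive_opp d2))).
    by rewrite [in RHS]mulrN.
  - by rewrite (@derive_val _ _ _ _ _ _ _ (is_derive_scale (2 * m)^-1 d2)).
  - rewrite (@derive_val _ _ _ _ _ _ _ (is_derive_scale (2 * m)^-1 (is_derive_opp d1))).
    by rewrite [in RHS]mulrN.
apply/rowP; apply: forall_ord3; rewrite !mxE /= dV ?mxE !dA /q /= !mxE /=.
all: by field.
Qed.

End PotentialBranch.

(** * The Gibbons-Hawking chart *)

Section GibbonsHawkingChart.
Variables (C : numClosedFieldType) (k : nat) (m : C).
Hypothesis m0 : m != 0.
Implicit Types (x v y : 'rV[C]_4).

(** X, Y, Z are such that X + Y, 2 Z, X - Y are m^2 q_0, m^2 q_1, m^2 q_2. *)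
Definition chart_of (q : nat -> C) (t : C) : 'rV[C]_4 :=
  \row_(i < 4) [:: m ^+ 2 / 2 * (q 0%N + q 2%N); m ^+ 2 / 2 * (q 0%N - q 2%N);
                   m ^+ 2 / 2 * q 1%N; t]`_i.

Definition gh_chart x : 'rV[C]_4 := chart_of (sq_coef x) (x 0 3).

Definition dgh_chart x v : 'rV[C]_4 := chart_of (dsq_coef x v) (v 0 3).

Lemma differentiable_gh_chart x j : differentiable (fun y => gh_chart y 0 j) x.
Proof.
have d n := differentiable_sq_coef x n.
under eq_fun do rewrite mxE.
elim/forall_ord4: j => /=; last exact: differentiable_coord.
all: apply: differentiable_mul => //.
- exact: differentiable_add.
- by apply: differentiable_add => //; exact: differentiable_opp.
Qed.

Lemma is_derive_gh_chart x v j :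
  is_derive x v (fun y => gh_chart y 0 j) (dgh_chart x v 0 j).
Proof.
have d n := is_derive_sq_coef x v n.
rewrite mxE; under eq_fun do rewrite mxE.
elim/forall_ord4: j => /=.
- exact: is_derive_scale (is_derive_add (d 0%N) (d 2%N)).
- exact: is_derive_scale (is_derive_add (d 0%N) (is_derive_opp (d 2%N))).
- exact: is_derive_scale (d 1%N).
- exact: is_derive_coord.
Qed.

Lemma jac_gh_chart x v : v *m jac gh_chart x = dgh_chart x v.
Proof.
apply/rowP => j; rewrite row_mul4.
have e i : jac gh_chart x i j = dgh_chart x (delta_mx 0 i) 0 j.
  by rewrite mxE /pd (@derive_val _ _ _ _ _ _ _ (is_derive_gh_chart x _ j)).
by rewrite !e !mxE; elim/forall_ord4: j {e} => /=; rewrite /dsq_coef ?mxE /=; ring.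
Qed.

Lemma jac_gh_chart_unit x : x 0 0 != 0 -> jac gh_chart x \in unitmx.
Proof.
move=> x0; apply: unitmx_inj => v; rewrite jac_gh_chart => /rowP e.
have n20 : 2 != 0 :> C by rewrite pnatr_eq0.
have mm : m ^+ 2 / 2 != 0 by rewrite mulf_neq0 ?expf_neq0 ?invr_eq0.
have := (e 0, e 1, e 2, e 3); rewrite !mxE /= => -[[[e0 e1] e2] v3].
have q1 : dsq_coef x v 1 = 0 by apply: (mulfI mm); rewrite e2 mulr0.
have s : dsq_coef x v 0 + dsq_coef x v 2 = 0 by apply: (mulfI mm); rewrite e0 mulr0.
have t : dsq_coef x v 0 - dsq_coef x v 2 = 0 by apply: (mulfI mm); rewrite e1 mulr0.
have q0 : dsq_coef x v 0 = 0.
  by apply: (mulfI n20); rewrite mulr0 -[RHS](addr0 0) -{1}s -t; ring.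
have q2 : dsq_coef x v 2 = 0 by move: s; rewrite q0 add0r.
have nz : 2 * x 0 0 != 0 by rewrite mulf_neq0.
have v0 : v 0 0 = 0 by apply: (mulfI nz); rewrite mulr0.
have v1 : v 0 1 = 0.
  by apply: (mulfI nz); rewrite mulr0 -q1 /dsq_coef /= v0; ring.
have v2 : v 0 2 = 0.
  by apply: (mulfI nz); rewrite mulr0 -q2 /dsq_coef /= v0 v1; ring.
by apply/rowP; elim/forall_ord4; rewrite [RHS]mxE.
Qed.

Lemma Kfield_jac x : Kfield x *m jac gh_chart x = delta_mx 0 3.
Proof.
rewrite jac_gh_chart; apply/rowP.
by elim/forall_ord4; rewrite !mxE /= /dsq_coef /= ?mxE /=; ring.
Qed.

Lemma XYZ_gh_chart x :
  [/\ XYZ (gh_chart x) 0 0 + XYZ (gh_chart x) 0 1 = (m * x 0 0) ^+ 2,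
      2 * XYZ (gh_chart x) 0 2 = m ^+ 2 * sq_coef x 1 &
      XYZ (gh_chart x) 0 0 - XYZ (gh_chart x) 0 1 = m ^+ 2 * sq_coef x 2].
Proof. by rewrite !mxE /= /sq_coef /=; split; field. Qed.

Variable r0 : C.

(** The points at which m x_0 is the chosen square root of X + Y. *)
Definition near_root x : Prop := `|m * x 0 0 - r0| < `|m * x 0 0 + r0|.

Lemma sqrtXY_gh_chart x : near_root x -> sqrtXY r0 (XYZ (gh_chart x)) = m * x 0 0.
Proof. by move=> nr; rewrite /sqrtXY; have [-> _ _] := XYZ_gh_chart x; exact: near_sqrt_uniq. Qed.

Lemma near_branch_gh_chart x : near_root x -> near_branch r0 (XYZ (gh_chart x)).
Proof. by move=> nr; rewrite /near_branch sqrtXY_gh_chart. Qed.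

Lemma gh_coef_gh_chart x n : near_root x -> gh_coef r0 (XYZ (gh_chart x)) n = inv_coef x n / m.
Proof.
move=> nr; rewrite /gh_coef sqrtXY_gh_chart //; have [_ -> ->] := XYZ_gh_chart x.
by rewrite invfM mulrC isqrt_coef_scale.
Qed.

Lemma gh_V_gh_chart x : near_root x -> gh_V k r0 (XYZ (gh_chart x)) = potential k x / m.
Proof. by move=> nr; rewrite /gh_V gh_coef_gh_chart // /potential mulrAC. Qed.

(** In the chart the null form becomes V h_flat + (dT + A)^2 / V; the factor m
    of the metric is absorbed by the homogeneity of V. *)
Lemma metric_gh_chart x : x 0 0 != 0 -> potential k x != 0 -> near_root x ->
  m *: (coframe_mx k x *m null_gram C *m (coframe_mx k x)^T)
  = jac gh_chart x
    *m gibbons_hawking (h_flat (m ^- 2)) (gh_V k r0 (XYZ (gh_chart x)))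
         (gh_A k r0 m (XYZ (gh_chart x)))
    *m (jac gh_chart x)^T.
Proof.
move=> x0 V0 nr; apply/matrixP => i j; rewrite mxE !congr_entry.
rewrite null_gramE !coframe_mxE !jac_gh_chart gibbons_hawkingE gh_V_gh_chart //.
move: (delta_mx 0 i : 'rV_4) (delta_mx 0 j : 'rV_4) => v w.
rewrite !mxE /= !gh_coef_gh_chart // /coframe /theta /=.
have -> : inv_coef x (k - 1) = 2 * potential k x.
  by rewrite /potential mulrC divfK // pnatr_eq0.
move: (potential k x) V0 (inv_coef x _) (v 0 3) (w 0 3) => V V0 s v3 w3.
move: (dsq_coef x v 0) (dsq_coef x v 1) (dsq_coef x v 2) => p0 p1 p2.
move: (dsq_coef x w 0) (dsq_coef x w 1) (dsq_coef x w 2) => q0 q1 q2.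
by field; rewrite V0 m0.
Qed.

Lemma gh_chart_inj x y : near_root x -> near_root y ->
  gh_chart x = gh_chart y -> x = y.
Proof.
move=> nx ny e.
have n20 : 2 != 0 :> C by rewrite pnatr_eq0.
have m20 : m ^+ 2 != 0 by rewrite expf_neq0.
have z0 : x 0 0 = y 0 0.
  by apply: (mulfI m0); rewrite -!sqrtXY_gh_chart // e.
have x0 : x 0 0 != 0.
  by apply: contraTneq nx => x0; rewrite /near_root x0 mulr0 sub0r add0r normrN ltxx.
have [_ a1 a2] := XYZ_gh_chart x; have [_ b1 b2] := XYZ_gh_chart y.
have {a1 b1} q1 : sq_coef x 1 = sq_coef y 1 by apply: (mulfI m20); rewrite -a1 -b1 e.
have {a2 b2} q2 : sq_coef x 2 = sq_coef y 2 by apply: (mulfI m20); rewrite -a2 -b2 e.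
have nz : 2 * x 0 0 != 0 by rewrite mulf_neq0.
have z1 : x 0 1 = y 0 1 by apply: (mulfI nz); move: q1; rewrite /sq_coef /= z0.
have z2 : x 0 2 = y 0 2.
  by apply: (mulfI nz); move: q2; rewrite /sq_coef /= z1 z0 => /addrI.
have z3 : x 0 3 = y 0 3 by have /rowP/(_ 3) := e; rewrite !mxE.
by apply/rowP; elim/forall_ord4.
Qed.

Lemma near_rootP x : `|m * x 0 0 - r0| < `|r0| -> near_root x.
Proof.
move=> d; apply: (lt_trans d).
have -> : m * x 0 0 + r0 = r0 + r0 - (r0 - m * x 0 0) by ring.
apply: lt_le_trans (lerB_dist _ _); rewrite -mulr2n normrMn mulr2n.
by rewrite [`|r0 - _|]distrC -addrA ltrDl subr_gt0.
Qed.

Lemma near_ball x : `|m * x 0 0 - r0| < `|r0| ->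
  \forall y \near x, `|m * (y : 'rV[C]_4) 0 0 - r0| < `|r0|.
Proof.
move=> d.
have df : differentiable (fun y : 'rV[C]_4 => m * y 0 0 - r0) x.
  apply: differentiable_add; last exact: differentiable_const.
  by apply: differentiable_mul; [exact: differentiable_const|exact: differentiable_coord].
exact: cvgr_norm_lt (differentiable_continuous df) _ d.
Qed.

End GibbonsHawkingChart.

(** * The theorem *)

Lemma gh_domain_open (C : numClosedFieldType) k (r0 : C) :
  open [set w : 'rV[C]_3 | near_branch r0 w /\ gh_V k r0 w != 0].
Proof.
rewrite openE => w [nb V0].
have c := differentiable_continuous (differentiable_gh_V k nb).
have near_V : \forall w' \near w, gh_V k r0 w' != 0 by exact: cvgr_neq0 c V0.
have near_nb := near_near_branch nb.
by near=> w'; split; near: w'.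
Unshelve. all: by end_near. Qed.

(** The constant is the value of the conformal factor at any regular point; an
    empty regular domain imposes no condition. *)
Lemma twistor_metric_scale (R : realType) (k : nat) (a : Cplx R)
    (g : 'rV[Cplx R]_4 -> 'M[Cplx R]_4) :
  (3 <= k)%N -> a != 0 -> twistor_metric k a g ->
  exists2 m : Cplx R, m != 0 & forall x, regular_domain k a x ->
    g x = m *: (coframe_mx k x *m null_gram (Cplx R) *m (coframe_mx k x)^T).
Proof.
move=> k3 a0 gP.
have [[x rx]|none] := pselect (exists x, regular_domain k a x); last first.
  by exists 1 => [|x rx]; [exact: oner_neq0|case: none; exists x].
exists (conformal_factor k g x) => [|y ry].
  apply: contraTneq (twistor_metric_unit gP rx) => f0.
  by rewrite (metric_factor k3 a0 gP rx) f0 scale0r unitmxE det0 unitr0.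
apply: (etrans (metric_factor k3 a0 gP ry)); congr (_ *: _).
apply: (constant_on_regular_domain k3 a0) ry rx => [z|z i].
  exact: differentiable_conformal_factor.
exact: pd_conformal_factor.
Qed.

Theorem mainTheorem4 (R : realType) (k : nat) (a : Cplx R)
    (g : 'rV[Cplx R]_4 -> 'M[Cplx R]_4) :
  (3 <= k)%N -> a != 0 -> twistor_metric k a g ->
  (* K is Killing and tri-holomorphic *)
  (forall x, regular_domain k a x ->
     lie (@Kfield (Cplx R)) g x = 0 /\
     forall n : nat, (n < 3)%N -> lie (@Kfield (Cplx R)) (Sigma k a n) x = 0) /\
  (* Gibbons-Hawking form: constant scale c, orientation vol, and coordinates
     Phi = (X, Y, Z, T) *)
  (exists (c vol : Cplx R) (Phi : 'rV[Cplx R]_4 -> 'rV[Cplx R]_4),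
     [/\ c != 0,
         vol ^+ 2 = \det (h_flat c),
         (forall x, regular_domain k a x ->
            [/\ forall j, holomorphic_at (fun y => Phi y 0 j) x,
                jac Phi x \in unitmx &
                Kfield x *m jac Phi x = delta_mx 0 3]) &
      forall x0, regular_domain k a x0 ->
      exists (U : set 'rV[Cplx R]_4) (W : set 'rV[Cplx R]_3)
             (r : 'rV[Cplx R]_3 -> Cplx R)
             (s : 'rV[Cplx R]_3 -> Cplx R -> Cplx R)
             (V : 'rV[Cplx R]_3 -> Cplx R)
             (A : 'rV[Cplx R]_3 -> 'rV[Cplx R]_3),
        [/\ [/\ open U, U x0, U `<=` regular_domain k a & set_inj U Phi],
            [/\ open W, forall x, U x -> W (XYZ (Phi x)) & sqrt_branch W r s],
            (forall w, W w ->
               [/\ V w = GH_potential k (s w),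
                   V w != 0,
                   holomorphic_at V w,
                   forall i, holomorphic_at (fun w' => A w' 0 i) w &
                   grad V w = hodge (h_flat c) vol (ext_d A w)]),
            (forall x, U x ->
               g x = jac Phi x
                     *m gibbons_hawking (h_flat c) (V (XYZ (Phi x)))
                                        (A (XYZ (Phi x)))
                     *m (jac Phi x)^T /\
               V (XYZ (Phi x))
               = ((Kfield x *m g x *m (Kfield x)^T) 0 0)^-1) &
            (forall w, W w ->
               (k = 3%N ->
                  V w = - (w 0 0 ^+ 2 - w 0 1 ^+ 2 - 3 * w 0 2 ^+ 2)
                        / (4 * r w ^+ 5)) /\
               (k = 4%N ->
                  V w = w 0 2 * (3 * w 0 0 ^+ 2 - 3 * w 0 1 ^+ 2
                                 - 5 * w 0 2 ^+ 2)
                        / (4 * r w ^+ 7)))]]).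
Proof.
move=> k3 a0 gP; split=> [x rx|].
  by split=> [|n n3]; [exact: (killing k3 a0 gP rx)|exact: (triholomorphic k3 a0 rx n3)].
have [m m0 gE] := twistor_metric_scale k3 a0 gP.
exists (m ^- 2), (- m ^- 3), (gh_chart m); split.
- by rewrite invr_eq0 expf_neq0.
- by rewrite det_h_flat sqrrN -!exprVn -!exprM.
- move=> x /(regular_domainP k3 a0)[x0 V0]; split.
  + exact: differentiable_gh_chart.
  + exact: jac_gh_chart_unit.
  + exact: Kfield_jac.
move=> x0 rx0; have [x00 _] := (regular_domainP k3 a0 _).1 rx0.
pose r0 := m * x0 0 0.
have r00 : r0 != 0 by rewrite mulf_neq0.
exists [set x | regular_domain k a x /\ `|m * x 0 0 - r0| < `|r0|].
exists [set w | near_branch r0 w /\ gh_V k r0 w != 0].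
exists (sqrtXY r0), (branch r0), (gh_V k r0), (gh_A k r0 m); split.
- split=> [|||x y].
  + rewrite openE => x [rx bx].
    have near_r := near_regular k3 a0 rx; have near_b := near_ball bx.
    by near=> y; split; near: y.
  + by split=> //; rewrite subrr normr0 normr_gt0.
  + by move=> x [].
  + by rewrite !inE => -[_ bx] [_ by_]; exact: (gh_chart_inj m0 (near_rootP bx) (near_rootP by_)).
- split=> [|x [rx bx]|w [nb _]]; first exact: gh_domain_open.
    have nr := near_rootP bx; have [_ V0] := (regular_domainP k3 a0 _).1 rx.
    split; first exact: near_branch_gh_chart.
    by rewrite gh_V_gh_chart // mulf_neq0 // invr_eq0.
  exact: branch_sqrt.
- move=> w [nb V0]; split=> //.
  + exact: gh_V_potential.
  + exact: differentiable_gh_V.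
  + by move=> i; exact: gh_A_holomorphic.
  + exact: monopole.
- move=> x [rx bx]; have nr := near_rootP bx.
  have [xx0 V0] := (regular_domainP k3 a0 _).1 rx.
  split; first by rewrite gE // (metric_gh_chart m0 xx0 V0 nr).
  have -> : (Kfield x *m g x *m (Kfield x)^T) 0 0 = g x 3 3.
    by rewrite trmx_delta -colE [LHS]mxE -rowE mxE.
  rewrite gh_V_gh_chart // gE // mxE congr_entry null_gramE !coframe_mxE.
  rewrite /coframe /theta /dsq_coef !mxE /=.
  by move: (potential k x) V0 (inv_coef x _) => V V0 s; field; rewrite ?V0 ?m0.
- move=> w [nb _]; split=> kE; first exact: gh_V3.
  exact: gh_V4.
Unshelve. all: by end_near. Qed.
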